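(* Let $\Gamma$ be a countable amenable group and let $(X,T)$ be a $\Gamma$-dynamical system with the uniform Rokhlin property. Then $$\mathrm{mdim}(X,T)=\dim(X,T).$$
   Context: A $\Gamma$-dynamical system $(X,T)$ is a compact metric space $X$ with a homomorphism $T$, $\gamma\mapsto T_\gamma$, from the countable discrete group $\Gamma$ to the group of self-homeomorphisms of $X$. $\mathrm{Prob}(X,T)$ is the set of $T$-invariant Borel probability measures on $X$. $\mathrm{Cov}(X)$ is the set of finite open covers of $X$; $\mathcal{V}\succeq\mathcal{U}$ means every $V\in\mathcal{V}$ is contained in some $U\in\mathcal{U}$; $\mathrm{ord}(\mathcal{V},x)=-1+\sum_{V\in\mathcal{V}}\mathbf{1}_V(x)$. The new dimension is $$\dim(X,T)=\sup_{\mathcal{U}\in\mathrm{Cov}(X)}\ \inf_{\mathcal{V}\in\mathrm{Cov}(X),\,\mathcal{V}\succeq\mathcal{U}}\ \sup_{\mu\in\mathrm{Prob}(X,T)}\int_X \mathrm{ord}(\mathcal{V},x)\,d\mu(x),$$ with $\dim(X,T)=-\infty$ if $\mathrm{Prob}(X,T)=\emptyset$. Gromov's mean dimension is $$\mathrm{mdim}(X,T)=\sup_{\mathcal{U}\in\mathrm{Cov}(X)}\ \lim_{n\to\infty}\frac{1}{|F_n|}\ \inf_{\mathcal{V}\in\mathrm{Cov}(X),\ \mathcal{V}\succeq\bigvee_{\gamma\in F_n}T_\gamma(\mathcal{U})}\ \sup_{x\in X}\mathrm{ord}(\mathcal{V},x),$$ where $T_\gamma(\mathcal{U})=\{T_\gamma(U):U\in\mathcal{U}\}$,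 $\bigvee_{\gamma\in F}T_\gamma(\mathcal{U})$ is the cover consisting of all sets $\bigcap_{\gamma\in F}T_\gamma(U_\gamma)$ with $U_\gamma\in\mathcal{U}$, and $(F_n)$ is a Følner sequence of $\Gamma$, i.e. nonempty finite subsets with $|F_n\gamma\,\triangle\,F_n|/|F_n|\to0$ for every $\gamma\in\Gamma$ (the limit exists and does not depend on the choice of the sequence, by the Ornstein–Weiss lemma). For finite $K\subseteq\Gamma$ and $\epsilon>0$, a nonempty finite set $S\subseteq\Gamma$ is $(K,\epsilon)$-invariant if $|kS\,\triangle\,S|<\epsilon|S|$ for every $k\in K$. $(X,T)$ has the uniform Rokhlin property if for every finite $K\subseteq\Gamma$ and every $\epsilon>0$ there exist open sets $V_1,\dots,V_r\subseteq X$ and finite $(K,\epsilon)$-invariant sets $S_1,\dots,S_r\subseteq\Gamma$ such that the sets $T_\gamma V_i$ ($1\le i\le r$, $\gamma\in S_i$) are pairwise disjoint and $$\sup_{\mu\in\mathrm{Prob}(X,T)}\mu\Big(X\setminus\bigcup_{i=1}^r\bigcup_{\gamma\in S_i}T_\gamma V_i\Big)<\epsilon.$$ *)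

(* Defs.v *)
From HB Require Import structures.
From mathcomp Require Import all_boot all_order all_algebra finmap.
From mathcomp Require Import all_classical all_reals all_analysis.

Set Implicit Arguments.
Unset Strict Implicit.
Unset Printing Implicit Defensive.

Import Order.TTheory GRing.Theory Num.Theory.
Import numFieldNormedType.Exports.

Local Open Scope classical_set_scope.
Local Open Scope ring_scope.

Section Groups.
Context (R : realType) (G : groupType).

Definition fsymdiff (A B : {fset G}) : {fset G} :=
  ((A `\` B) `|` (B `\` A))%fset.

(* Translates are on the right here, and on the left in [invariant_fset]: both
   match the convention that the join in [mdim] is over T g (U), g \in F n. *)
Definition folner (F : nat -> {fset G}) : Prop :=
  (forall n, F n != fset0) /\
  forall g : G,
    (fun n => #|` fsymdiff [fset (x * g)%g | x in F n]%fset (F n)|%:R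
              / #|` F n|%:R : R) @ \oo --> (0 : R).

Definition amenable : Prop := exists F : nat -> {fset G}, folner F.

Definition invariant_fset (K : {fset G}) (eps : R) (S : {fset G}) : Prop :=
  S != fset0 /\
  forall k, k \in K ->
    #|` fsymdiff [fset (k * s)%g | s in S]%fset S|%:R < eps * #|` S|%:R :> R.

End Groups.

Section Dynamics.
Context (G : groupType) (X : topologicalType).

Definition homeomorphism (f : X -> X) : Prop :=
  continuous f /\
  exists f' : X -> X, [/\ continuous f', cancel f f' & cancel f' f].

Definition dynamical_system (T : G -> X -> X) : Prop :=
  (forall g, homeomorphism (T g)) /\
  (forall g h, T (g * h)%g = T g \o T h).

End Dynamics.

(* Measurable types are pointed in the library, whereas X may be empty: the
   Borel space of X is therefore formed relative to a base point x0, on which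
   neither its sigma-algebra nor the integrals depend. *)
Definition pointed_at (X : Type) (x0 : X) : Type := X.

HB.instance Definition _ (X : choiceType) (x0 : X) :=
  Choice.on (pointed_at x0).
HB.instance Definition _ (X : choiceType) (x0 : X) :=
  isPointed.Build (pointed_at x0) x0.

Definition borel (X : topologicalType) (x0 : X) :=
  g_sigma_algebraType (@open X : set (set (pointed_at x0))).

Section Covers.
Context (R : realType) (X : topologicalType).

Definition finite_open_cover (C : set (set X)) : Prop :=
  [/\ finite_set C, forall U, C U -> open U & \bigcup_(U in C) U = setT].

Definition refines (V U : set (set X)) : Prop :=
  forall A, V A -> exists2 B, U B & A `<=` B.

Definition ord (C : set (set X)) (x : X) : R :=
  -1 + \sum_(V \in C) (\1_V x : R).

Definition join_cover (G : groupType) (T : G -> X -> X) (F : {fset G})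
    (C : set (set X)) : set (set X) :=
  [set W | exists2 u : G -> set X, (forall g, g \in F -> C (u g)) &
           W = \bigcap_(g in [set g | g \in F]) (T g @` u g)].

End Covers.

Section Dimensions.
Context (R : realType) (G : groupType) (X : metricType R).
Local Open Scope ereal_scope.

Record invariant_probability (T : G -> X -> X) := InvariantProbability {
  base_point : X;
  law :> probability (borel base_point) R;
  law_invariant : forall (g : G) (A : set (borel base_point)),
    measurable A -> law (T g @^-1` A) = law A }.

(* If there is no invariant probability, this is -oo because [ereal_sup set0]
   is -oo and every finite open cover refines itself; [measure_dim] is then -oo. *)
Definition sup_integral_ord (T : G -> X -> X) (C : set (set X)) : \bar R :=
  ereal_sup [set \int[law mu]_x (ord R C x)%:E
            | mu in [set: invariant_probability T]].

Definition measure_dim (T : G -> X -> X) : \bar R :=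
  ereal_sup [set ereal_inf [set sup_integral_ord T V
                           | V in [set V | finite_open_cover V /\ refines V U]]
            | U in [set U | finite_open_cover U]].

Definition min_ord (U : set (set X)) : \bar R :=
  ereal_inf [set ereal_sup [set (ord R V x)%:E | x in [set: X]]
            | V in [set V | finite_open_cover V /\ refines V U]].

Definition mdim (F : nat -> {fset G}) (T : G -> X -> X) : \bar R :=
  ereal_sup [set limn (fun n => (#|` F n|%:R^-1)%:E
                                * min_ord (join_cover T (F n) U))
            | U in [set U | finite_open_cover U]].

Definition uniform_rokhlin (T : G -> X -> X) : Prop :=
  forall (K : {fset G}) (eps : R), (0 < eps)%R ->
  exists (r : nat) (V : 'I_r -> set X) (S : 'I_r -> {fset G}),
    [/\ forall i, open (V i),
        forall i, invariant_fset K eps (S i),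
        trivIset [set p : 'I_r * G | p.2 \in S p.1]
                 (fun p => T p.2 @` V p.1) &
        ereal_sup [set law mu (~` \bigcup_(i in [set: 'I_r])
                                   \bigcup_(g in [set g | g \in S i])
                                     (T g @` V i))
                  | mu in [set: invariant_probability T]] < eps%:E].

End Dimensions.

(* Main.v *)
Require Import Defs.
From HB Require Import structures.
From mathcomp Require Import all_boot all_order all_algebra finmap.
From mathcomp Require Import all_classical all_reals all_analysis.
From mathcomp Require Import measurable_realfun zify lra.

Set Implicit Arguments.
Unset Strict Implicit.
Unset Printing Implicit Defensive.

Import Order.TTheory GRing.Theory Num.Theory.
Import numFieldNormedType.Exports.

Local Open Scope classical_set_scope.
Local Open Scope ring_scope.

(** Both dimensions are suprema over the finite open covers U, and they already
agree term by term. Let X be nonempty, fix U, write D(U) for the infimum, over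
the covers V refining U, of the supremum over mu of the integral of ord(V), and
let h(S) be the least order of a cover refining the join of the T_g(U), g in S.
The claim is that h(F_n) / |F_n| tends to D(U).

The topology enters through one combinatorial remark. A partition of unity
subordinate to an enumerated cover turns every point x into a subdivision of
[0, 1] into consecutive intervals, one for each member of the cover, and the
number of nondegenerate ones is at most the number of members containing x.
Two subdivisions with p and q nondegenerate intervals overlap along at most
p + q - 1 pairs of intervals ([overlap_count]). Overlapping the subdivisions of
two covers gives a common refinement whose order is at every point at most the
sum of the two orders ([join_open_seq]). Overlapping the subdivision of one
cover with k equal intervals, which plays the dual role, gives k covers
refining the given one and whose orders at x add up to at most its order at x
([split_open_seq]).

By the first construction h is subadditive, and it is invariant under left
translation, so the lemma of Ornstein and Weiss ([ornstein_weiss]) yields a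
limit b of h(F_n) / |F_n|, with h(S) <= (b + e) |S| for all sufficiently right
invariant S.

The inequality b <= D(U) holds without towers ([order_eventually_le]). If V
refines U, joining the translates of V over F_n bounds h(F_n) by the sums of
ord(V) along the orbit pieces T_g^-1(x), g in F_n. Such averages cannot
exceed, for infinitely many n, a bound c on the integrals of ord(V): an
ultrafilter limit of the empirical means would be an invariant finitely
additive mean, and the regular Borel measure derived from it is an invariant
probability measure under which every closed set weighs at least as much as
under the mean ([empirical_limit]). As ord(V) is only lower semicontinuous, V
is first replaced by closed shrinkings of its members.

The inequality D(U) <= b uses the Rokhlin towers ([tower_cover]). On a tower
with base V and shape S, choose a cover of order at most (b + e) |S| refining
the join of the T_g(U) over g in S^-1, and split it into |S| covers, one for
each level T_s(V). The orders seen along the tower then add up to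
(b + e) |S|, and not to |S| times that much, so the integral of the order over
the towers is at most b + e. The rest of the space is closed and small for
all invariant measures; it has an open neighbourhood that is just as small
([uniformly_small_neighborhood]), on which U itself is used. *)

(** * Subdivisions of the unit interval *)

Section Subdivisions.
Context (R : realType).
Implicit Types (s t : nat -> R) (m n : nat).

Definition subdivision s m :=
  [/\ s 0%N = 0, s m = 1 & forall i, s i <= s i.+1].

Lemma subdivision_le s m i j : subdivision s m -> (i <= j)%N -> s i <= s j.
Proof.
move=> [_ _ s_nd].
exact: (homo_leq (@lexx _ R) (fun x y z => @le_trans _ R x y z)).
Qed.

Lemma subdivision_mem s m (r : R) : subdivision s m -> 0 <= r < 1 ->
  exists2 i, (i < m)%N & s i <= r < s i.+1.
Proof.
move=> [s0 sm _] /andP[r0 r1].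
have ex : exists i, r < s i by exists m; rewrite sm.
case: (ex_minnP ex) => -[|i] ri mini; first by move: ri; rewrite s0 ltNge r0.
exists i; first by apply: mini; rewrite sm.
by rewrite ri andbT leNgt; apply/negP => /mini; rewrite ltnn.
Qed.

Definition overlap s t (p : nat * nat) :=
  Num.max (s p.1) (t p.2) < Num.min (s p.1.+1) (t p.2.+1).

Lemma overlapE s t p : overlap s t p =
  [&& s p.1 < s p.1.+1, s p.1 < t p.2.+1, t p.2 < s p.1.+1 & t p.2 < t p.2.+1].
Proof.
rewrite /overlap lt_min !gt_max.
by case: (s p.1 < _); case: (t p.2 < _); rewrite ?andbF ?andbT.
Qed.

(** A pair of overlapping intervals is determined by whichever of the two ends
first, the interval of s in case of a tie. This injects the overlapping pairs
into the nondegenerate intervals of s and t together, and misses the last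
nondegenerate interval of t, which ends at 1 and never strictly first. *)
Lemma overlap_count s t m n : subdivision s m -> subdivision t n ->
  (count (overlap s t) [seq (i, j) | i <- iota 0 m, j <- iota 0 n] <
   count (fun i => (s i < s i.+1)%R) (iota 0 m) +
   count (fun j => (t j < t j.+1)%R) (iota 0 n))%N.
Proof.
move=> sm tn; have [j0 j0n tj0] : exists2 j, (j < n)%N & t j < t j.+1 /\ t j.+1 = 1.
  have ex : exists i, 1 <= t i by exists n; case: tn => _ ->.
  case: (ex_minnP ex) => -[|j] tj minj.
    by move: tj; case: tn => -> _ _; rewrite ler10.
  have jn : (j < n)%N by apply: minj; case: tn => _ ->.
  exists j => //; have t1 : t j.+1 = 1.
    apply/eqP; rewrite eq_le tj andbT.
    by have := subdivision_le tn jn; case: (tn) => _ -> _.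
  split=> //; rewrite t1 ltNge; apply/negP => /minj; by rewrite ltnn.
pose code (p : nat * nat) : nat + nat :=
  if s p.1.+1 <= t p.2.+1 then inl p.1 else inr p.2.
set P := [seq i <- iota 0 m | s i < s i.+1].
set Q := [seq j <- iota 0 n | t j < t j.+1].
have j0Q : j0 \in Q by rewrite mem_filter tj0.1 mem_iota.
rewrite -[X in (_ < X + _)%N]size_filter -[X in (_ < _ + X)%N]size_filter.
rewrite -/P -/Q -size_filter.
set A := [seq p <- _ | overlap s t p].
have step (u : nat -> R) k a b : subdivision u k -> u a < u b.+1 -> (a <= b)%N.
  move=> uk; rewrite leqNgt; apply: contraTN => /(subdivision_le uk).
  by rewrite leNgt.
have inA p : p \in A -> [/\ (p.1 < m)%N, (p.2 < n)%N & overlap s t p].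
  rewrite mem_filter => /andP[ov /allpairsP[[i j] /= [im jn pE]]].
  by move: im jn ov; rewrite !mem_iota pE.
have uA : uniq (map code A).
  rewrite map_inj_in_uniq; last first.
    move=> [i j] [i' j'] /inA[_ _ +] /inA[_ _ +]; rewrite !overlapE /=.
    move=> /and4P[si sitj tjsi tj] /and4P[si' sitj' tjsi' tj'].
    rewrite /code /=; case: ifPn => h; case: ifPn => h' // -[eqij].
      rewrite -eqij in si' sitj' tjsi' h' *; congr (_, _).
      by apply/eqP; rewrite eqn_leq (step _ _ _ _ tn (lt_le_trans tjsi h'))
        (step _ _ _ _ tn (lt_le_trans tjsi' h)).
    rewrite -eqij in tj' sitj' tjsi' h' *; congr (_, _).
    rewrite -!ltNge in h h'.
    by apply/eqP; rewrite eqn_leq (step _ _ _ _ sm (lt_trans sitj h'))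
        (step _ _ _ _ sm (lt_trans sitj' h)).
  by rewrite filter_uniq // allpairs_uniq ?iota_uniq // => -[? ?] [? ?] _ _ [-> ->].
have sub : {subset map code A <= map inl P ++ map inr (rem j0 Q)}.
  move=> c /mapP[[i j] /inA[/= im jn]]; rewrite overlapE /= => /and4P[si sitj tjsi tj] ->.
  rewrite /code /= mem_cat; case: ifPn => h.
    by rewrite map_f // mem_filter si mem_iota.
  apply/orP; right; rewrite map_f // mem_rem_uniq ?filter_uniq ?iota_uniq //.
  rewrite inE mem_filter tj mem_iota /= jn andbT.
  apply: contraNneq h => ->; rewrite tj0.2.
  by have := subdivision_le sm im; case: (sm) => _ -> _.
have := uniq_leq_size uA sub.
rewrite size_cat !size_map size_rem //.
have : (0 < size Q)%N by rewrite lt0n size_eq0; apply: contraTneq j0Q => ->.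
by move=> Q0 /leq_ltn_trans; apply; rewrite ltn_add2l ltn_predL.
Qed.

Lemma uniform_subdivision k : (0 < k)%N -> subdivision (fun j => j%:R / k%:R) k.
Proof.
move=> k0; split=> [||i]; first by rewrite mul0r.
  by rewrite divff // pnatr_eq0 -lt0n.
by rewrite ler_pM2r ?invr_gt0 ?ltr0n // ler_nat.
Qed.

End Subdivisions.

(** The order of a cover at x is its multiplicity at x minus one, if no member is
listed twice. *)
Definition mult (X : Type) (L : seq (set X)) (x : X) : nat :=
  count (fun A => x \in A) L.

Section Multiplicity.
Context (X : topologicalType).
Implicit Types (L M : seq (set X)) (A B : set X).

Definition open_seq L := forall A, A \in L -> open A.
Definition covering L := forall x, exists2 A, A \in L & A x.

Lemma mult_nth L x :
  mult L x = count (fun i => x \in nth set0 L i) (iota 0 (size L)).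
Proof. by rewrite /mult -{1}(mkseq_nth set0 L) /mkseq count_map. Qed.

Lemma mult_map (I : Type) (D : I -> set X) (r : seq I) x :
  mult (map D r) x = count (fun i => x \in D i) r.
Proof. by rewrite /mult count_map. Qed.

Lemma covering_mult_gt0 L x : covering L -> (0 < mult L x)%N.
Proof.
move=> /(_ x)[A AL Ax]; rewrite -has_count; apply/hasP.
by exists A => //; rewrite inE.
Qed.

End Multiplicity.

Section PartitionsOfUnity.
Context (R : realType) (X : metricType R).
Implicit Types (L M : seq (set X)) (A B : set X).

(** The distance to the complement of A, truncated at 1 so that A may be the
whole space. *)
Definition depth A (x : X) : R := inf (1 |` [set mdist x y | y in ~` A]).

Let depth_has_inf A x : has_inf (1 |` [set mdist x y | y in ~` A]).
Proof.
split; first by exists 1; left.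
by exists 0 => _ [->//|[y _ <-]]; rewrite mdist_ge0.
Qed.

Lemma depth_ge0 A x : 0 <= depth A x.
Proof.
apply: lb_le_inf; first by exists 1; left.
by move=> _ [->//|[y _ <-]]; rewrite mdist_ge0.
Qed.

Lemma depth_gt0P A x : open A -> 0 < depth A x <-> A x.
Proof.
move=> oA; split.
  apply: contraPP => nAx; apply/negP; rewrite -leNgt.
  apply: ge_inf; first by case: (depth_has_inf A x).
  by right; exists x => //; rewrite mdistxx.
move=> Ax; have /nbhs_ballP[e /= e0 eA] := open_nbhs_nbhs (conj oA Ax).
apply: (@lt_le_trans _ _ (Num.min 1 e)); first by rewrite lt_min ltr01 e0.
apply: lb_le_inf; first by exists 1; left.
move=> _ [->//|[y nAy <-]]; first by rewrite ge_min lexx.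
rewrite ge_min; apply/orP; right; rewrite leNgt; apply/negP => xy.
by apply: nAy; apply: eA; rewrite ballEmdist.
Qed.

Let depth_lip A x y : depth A x <= depth A y + mdist x y.
Proof.
rewrite -lerBlDr; apply: lb_le_inf; first by exists 1; left.
move=> _ [->|[z nAz <-]].
  rewrite lerBlDr; apply: ler_wpDr; first by rewrite mdist_ge0.
  by apply: ge_inf; [case: (depth_has_inf A x)|left].
rewrite lerBlDr; apply: (@le_trans _ _ (mdist x z)).
  apply: ge_inf; first by case: (depth_has_inf A x).
  by right; exists z.
by rewrite addrC metric_triangle.
Qed.

Lemma depth_continuous A : continuous (depth A).
Proof.
move=> x; apply/cvgrPdist_lt => e e0; near=> y.
have xy : mdist x y < e.
  near: y; apply/nbhs_ballP; exists e => // y; by rewrite ballEmdist.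
rewrite ltr_norml; have := depth_lip A x y; have := depth_lip A y x.
rewrite [mdist y x]metric_sym; lra.
Unshelve. all: by end_near. Qed.

(** The k-th point of the subdivision at x is the sum of the first k functions
of the partition of unity given by the normalized depths of the members. *)
Lemma partition_of_unity L : open_seq L -> covering L ->
  exists s : nat -> X -> R,
    [/\ forall k, continuous (s k),
        forall x, subdivision (s^~ x) (size L) &
        forall k x, s k x < s k.+1 x -> nth set0 L k x].
Proof.
move=> oL cL.
pose f k x := \sum_(i < k) depth (nth set0 L i) x.
have fS k x : f k.+1 x = f k x + depth (nth set0 L k) x.
  by rewrite /f big_ord_recr.
have f_cont k : continuous (f k).
  elim: k => [|k ih] x.
    rewrite [f 0%N](_ : _ = cst 0); first exact: cvg_cst.
    by apply/funext => y; rewrite /f big_ord0.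
  rewrite [f k.+1](_ : _ = f k \+ depth (nth set0 L k)).
    by apply: cvgD; [exact: ih|exact: depth_continuous].
  by apply/funext => y; rewrite fS.
have oN k : open (nth set0 L k).
  have [kL|kL] := ltnP k (size L); first by apply: oL; rewrite mem_nth.
  by rewrite nth_default //; exact: open0.
have f_gt0 x : 0 < f (size L) x.
  have [A AL Ax] := cL x; have iL : (index A L < size L)%N by rewrite index_mem.
  rewrite /f (bigD1 (Ordinal iL)) //= ltr_wpDr // ?sumr_ge0 // => [i _|].
    exact: depth_ge0.
  by rewrite nth_index //; apply/depth_gt0P => //; exact: oL.
exists (fun k x => f k x / f (size L) x); split.
- move=> k x; apply: cvgM; first exact: f_cont.
  by apply: cvgV; [rewrite gt_eqF|exact: f_cont].
- move=> x; split; first by rewrite /f big_ord0 mul0r.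
    by rewrite divff // gt_eqF.
  by move=> i; rewrite ler_pM2r ?invr_gt0 // fS lerDl depth_ge0.
- move=> k x; rewrite ltr_pM2r ?invr_gt0 // fS ltrDl => h.
  by apply/depth_gt0P.
Qed.

End PartitionsOfUnity.

(** * Refining, splitting and shrinking open covers *)

Section CoverRefinements.
Context (R : realType) (X : metricType R).
Implicit Types (L M : seq (set X)) (A B : set X).

Lemma open_lt_continuous (f g : X -> R) : continuous f -> continuous g ->
  open [set x | f x < g x].
Proof.
move=> cf cg; rewrite [X in open X](_ : _ = (g - f) @^-1` [set r | 0 < r]).
  apply: open_comp; last exact: open_gt.
  by move=> x _; apply: cvgB; [exact: cg|exact: cf].
by apply/seteqP; split=> x /=; rewrite !fctE subr_gt0.
Qed.

Lemma open_overlap (s t : nat -> X -> R) p :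
  (forall k, continuous (s k)) -> (forall k, continuous (t k)) ->
  open [set x | overlap (s^~ x) (t^~ x) p].
Proof.
move=> cs ct.
rewrite [X in open X](_ : _ = [set x | s p.1 x < s p.1.+1 x] `&`
  [set x | s p.1 x < t p.2.+1 x] `&` [set x | t p.2 x < s p.1.+1 x] `&`
  [set x | t p.2 x < t p.2.+1 x]).
  by do ![apply: openI]; apply: open_lt_continuous.
apply/seteqP; split=> x /=; rewrite overlapE; first by move=> /and4P[].
by move=> [[[-> ->] ->] ->].
Qed.

Lemma positive_part_count L (s : nat -> X -> R) x :
  (forall k, s k x < s k.+1 x -> nth set0 L k x) ->
  (count (fun i => (s i x < s i.+1 x)%R) (iota 0 (size L)) <= mult L x)%N.
Proof. by move=> sL; rewrite mult_nth; apply: sub_count => i /sL; rewrite inE. Qed.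

(** In terms of orders, ord(W) <= ord(L) + ord(M) at every point: this is where
products of nerves would be triangulated in a geometric proof. *)
Lemma join_open_seq L M : open_seq L -> covering L -> open_seq M -> covering M ->
  exists W, [/\ open_seq W, covering W, refines [set` W] [set` L],
    refines [set` W] [set` M] & forall x, (mult W x < mult L x + mult M x)%N].
Proof.
move=> oL cL oM cM.
have [s [cs ss sL]] := partition_of_unity oL cL.
have [t [ct st tM]] := partition_of_unity oM cM.
pose D p := [set x | overlap (s^~ x) (t^~ x) p].
pose I := [seq (i, j) | i <- iota 0 (size L), j <- iota 0 (size M)].
have inI p : p \in I -> (p.1 < size L)%N /\ (p.2 < size M)%N.
  by move=> /allpairsP[[i j] /= []]; rewrite !mem_iota => iL jM ->.
exists (map D I); split.
- by move=> _ /mapP[p _ ->]; exact: open_overlap.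
- move=> x; have [j jM /andP[tj tjS]] : exists2 j, (j < size M)%N & t j x <= 0 < t j.+1 x.
    by apply: (subdivision_mem (st x)); rewrite lexx ltr01.
  have [i iL /andP[si siS]] : exists2 i, (i < size L)%N & s i x <= 0 < s i.+1 x.
    by apply: (subdivision_mem (ss x)); rewrite lexx ltr01.
  exists (D (i, j)).
    by apply: map_f; apply/allpairsP; exists (i, j); rewrite !mem_iota.
  rewrite /D /= overlapE /= (le_lt_trans si siS) (le_lt_trans si tjS).
  by rewrite (le_lt_trans tj siS) (le_lt_trans tj tjS).
- move=> _ /= /mapP[[i j] /inI[/= iL _] ->]; exists (nth set0 L i); first exact: mem_nth.
  by move=> x; rewrite /D /= overlapE /= => /and4P[/sL].
- move=> _ /= /mapP[[i j] /inI[/= _ jM] ->]; exists (nth set0 M j); first exact: mem_nth.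
  by move=> x; rewrite /D /= overlapE /= => /and4P[_ _ _ /tM].
- move=> x; rewrite mult_map.
  apply: leq_trans (leq_add (positive_part_count (sL^~ x))
    (positive_part_count (tM^~ x))).
  apply: leq_ltn_trans (overlap_count (ss x) (st x)); rewrite eq_leq //.
  by apply: eq_count => p; rewrite /D; apply/idP/idP; rewrite inE.
Qed.

(** The members of the j-th cover are the sets of points at which the interval
of a given member of L meets the interval ]j / k, (j + 1) / k[. In terms of
orders, the sum of the ord(C j) is at most ord(L). *)
Lemma split_open_seq L k : (0 < k)%N -> open_seq L -> covering L ->
  exists C : nat -> seq (set X),
    [/\ forall j, (j < k)%N ->
         [/\ open_seq (C j), covering (C j) & refines [set` C j] [set` L]] &
     forall x, (\sum_(j <- iota 0 k) mult (C j) x < mult L x + k)%N].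
Proof.
move=> k0 oL cL.
have [s [cs ss sL]] := partition_of_unity oL cL.
pose t j (x : X) : R := j%:R / k%:R.
have ct j : continuous (t j) by move=> x; exact: cvg_cst.
have st x : subdivision (t^~ x) k by exact: uniform_subdivision.
pose D p := [set x | overlap (s^~ x) (t^~ x) p].
exists (fun j => [seq D (i, j) | i <- iota 0 (size L)]); split=> [j jk|x]; last first.
  have := overlap_count (ss x) (st x).
  set a := (count _ _ < _)%N => aP.
  apply: leq_trans (leq_add (positive_part_count (sL^~ x)) (leqnn k)).
  rewrite -[X in (_ < _ + X)%N](size_iota 0 k).
  apply: leq_trans (leq_ltn_trans _ aP) _; last first.
    by rewrite leq_add2l count_size.
  rewrite -sum1_count [X in (_ <= X)%N]big_mkcond big_allpairs exchange_big /=.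
  apply: leq_sum => j _; rewrite mult_map -sum1_count big_mkcond.
  rewrite eq_leq //; apply: eq_bigr => i _; congr (if _ then _ else _).
  by apply/idP/idP; rewrite /D inE.
split.
- by move=> _ /mapP[p _ ->]; exact: open_overlap.
- move=> x.
  have tj : t j x < t j.+1 x by rewrite /t ltr_pM2r ?invr_gt0 ?ltr0n // ltr_nat.
  have [i iL /andP[si siS]] : exists2 i, (i < size L)%N & s i x <= t j x < s i.+1 x.
    apply: (subdivision_mem (ss x)); rewrite divr_ge0 //=.
    by rewrite ltr_pdivrMr ?ltr0n // mul1r ltr_nat.
  exists (D (i, j)); first by apply: map_f; rewrite mem_iota.
  by rewrite /D /= overlapE /= (le_lt_trans si siS) (le_lt_trans si tj) siS tj.
- move=> _ /= /mapP[i + ->]; rewrite mem_iota => /= iL.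
  exists (nth set0 L i); first exact: mem_nth.
  by move=> x; rewrite /D /= overlapE /= => /and4P[/sL].
Qed.

(** Some function of a partition of unity by m functions is at least 1 / m at x,
hence exceeds the threshold 1 / (m + 1). *)
Lemma shrink_open_seq L : open_seq L -> covering L ->
  exists O Ks : seq (set X),
    [/\ open_seq O, covering O, refines [set` O] [set` L],
        forall K, K \in Ks -> closed K &
        forall x, (mult O x <= mult Ks x <= mult L x)%N].
Proof.
move=> oL cL; have [s [cs ss sL]] := partition_of_unity oL cL.
pose e : R := (size L).+1%:R^-1.
have e0 : 0 < e by rewrite invr_gt0 ltr0n.
pose r k x := s k.+1 x - s k x.
have cr k : continuous (r k) by move=> x; apply: cvgB; exact: cs.
exists [seq [set x | e < r i x] | i <- iota 0 (size L)].
exists [seq [set x | e <= r i x] | i <- iota 0 (size L)]; split.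
- move=> _ /mapP[i _ ->]; apply: (@open_lt_continuous (cst e)) => // x; exact: cvg_cst.
- move=> x; apply: contrapT => h.
  have le k : (k <= size L)%N -> s k x <= k%:R * e.
    elim: k => [_|k ih kL]; first by rewrite mul0r; case: (ss x) => ->.
    have : r k x <= e.
      rewrite leNgt; apply/negP => erk; apply: h; exists [set x | e < r k x] => //.
      by apply: map_f; rewrite mem_iota.
    rewrite /r -natr1 mulrDl mul1r; move: (ih (ltnW kL)); lra.
  have := le _ (leqnn _); case: (ss x) => _ -> _.
  by rewrite ler_pdivlMr ?ltr0n // mul1r ler_nat ltnn.
- move=> _ /= /mapP[i + ->]; rewrite mem_iota => /= iL.
  exists (nth set0 L i); first exact: mem_nth.
  by move=> x /= er; apply: sL; rewrite -subr_gt0 (lt_trans e0).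
- move=> _ /mapP[i _ ->]; rewrite [X in closed X](_ : _ = ~` [set x | r i x < e]).
    apply: open_closedC; apply: (@open_lt_continuous _ (cst e)) => // x; exact: cvg_cst.
  by apply/seteqP; split=> x /=; rewrite leNgt => /negP.
- move=> x; rewrite !mult_map mult_nth; apply/andP.
  split; apply: sub_count => i; rewrite !inE.
    exact: ltW.
  by move=> /= er; apply: sL; rewrite -subr_gt0 (lt_le_trans e0).
Qed.

End CoverRefinements.

(** * The Ornstein-Weiss lemma *)

Section Translates.
Context (G : groupType).
Implicit Types (A B F Q S : {fset G}) (c g k : G).

Definition ltrans g A : {fset G} := [fset (g * x)%g | x in A]%fset.
Definition rtrans A g : {fset G} := [fset (x * g)%g | x in A]%fset.
Definition fset_mul Q F : {fset G} := [fset (c * f)%g | c in Q, f in F]%fset.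

Lemma in_ltrans g A x : (x \in ltrans g A) = ((g^-1 * x)%g \in A).
Proof.
apply/imfsetP/idP => [[y /= yA ->]|h]; first by rewrite mulKg.
by exists (g^-1 * x)%g => //; rewrite mulVKg.
Qed.

Lemma in_rtrans g A x : (x \in rtrans A g) = ((x * g^-1)%g \in A).
Proof.
apply/imfsetP/idP => [[y /= yA ->]|h]; first by rewrite mulgK.
by exists (x * g^-1)%g => //; rewrite mulgVK.
Qed.

Lemma card_ltrans g A : #|` ltrans g A| = #|` A|.
Proof. by rewrite card_imfset //; exact: mulgI. Qed.

Definition defect k A := #|` fsymdiff (rtrans A k) A|.

(** With the next two lemmas, this keeps unions, differences and left translates
of nearly invariant sets nearly invariant. *)
Lemma defectU k A B : (defect k (A `|` B)%fset <= defect k A + defect k B)%N.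
Proof.
apply: leq_trans (leq_card_fsetU _ _); apply: fsubset_leq_card.
apply/fsubsetP => x; rewrite /fsymdiff !(in_fsetU, in_fsetD, in_rtrans).
by do 4 case: (_ \in _).
Qed.

Lemma defectD k A B : (defect k (A `\` B)%fset <= defect k A + defect k B)%N.
Proof.
apply: leq_trans (leq_card_fsetU _ _); apply: fsubset_leq_card.
apply/fsubsetP => x; rewrite /fsymdiff !(in_fsetU, in_fsetD, in_rtrans).
by do 4 case: (_ \in _).
Qed.

Lemma defect_ltrans k c A : defect k (ltrans c A) = defect k A.
Proof.
rewrite /defect -[RHS](card_ltrans c); congr #|` _|; apply/fsetP => x.
by rewrite /fsymdiff !(in_fsetU, in_fsetD, in_rtrans, in_ltrans) mulgA.
Qed.

Lemma fset_mul1U c Q F : fset_mul (c |` Q)%fset F = (ltrans c F `|` fset_mul Q F)%fset.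
Proof.
apply/fsetP => x; rewrite in_fsetU in_ltrans; apply/imfset2P/orP.
  move=> [d /= + [f /= fF ->]]; rewrite in_fset1U => /orP[/eqP->|dQ].
    by left; rewrite mulKg.
  by right; apply/imfset2P; exists d => //; exists f.
move=> [h|/imfset2P[d /= dQ [f /= fF ->]]].
  by exists c; [rewrite /= in_fset1U eqxx|exists (c^-1 * x)%g => //; rewrite mulVKg].
by exists d; [rewrite /= in_fset1U dQ orbT|exists f].
Qed.

(** The product Q F is a union of left translates of F. *)
Lemma subadditive_fset_mul (f : {fset G} -> nat) F Q :
  f fset0 = 0%N -> (forall A B, f (A `|` B)%fset <= f A + f B)%N ->
  (forall c A, f (ltrans c A) = f A) ->
  (f (fset_mul Q F) <= #|` Q| * f F)%N.
Proof.
move=> f0 fU fl; elim/finSet_rect: Q => Q ih.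
have [->|[c cQ]] := fset_0Vmem Q.
  by rewrite [fset_mul _ _](_ : _ = fset0) ?f0 //; apply/fsetP => x; rewrite in_fset0;
    apply/negbTE/imfset2P => -[].
rewrite -(fsetD1K cQ) fset_mul1U cardfsU1 !inE eqxx /= mulSn.
apply: leq_trans (fU _ _) _; rewrite fl leq_add2l.
by apply: ih; rewrite fproperD1.
Qed.

End Translates.

Section OrnsteinWeiss.
Context (R : realType) (G : groupType).
Implicit Types (A B F Q S K : {fset G}) (c g k : G).

(** This is [invariant_fset] for translations on the right, the convention of
[folner]; inversion of S exchanges the two. *)
Definition right_invariant K (eps : R) S :=
  S != fset0 /\ forall k, k \in K -> (defect k S)%:R < eps * #|` S|%:R.

Context (h : {fset G} -> nat).
Hypothesis h0 : h fset0 = 0%N.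
Hypothesis hU : forall A B, (h (A `|` B)%fset <= h A + h B)%N.
Hypothesis hl : forall c A, h (ltrans c A) = h A.

Let C : R := (h [fset 1%g]%fset)%:R.

Lemma h_le_card A : (h A)%:R <= C * #|` A|%:R.
Proof.
rewrite /C -natrM ler_nat mulnC.
apply: leq_trans (subadditive_fset_mul _ _ h0 hU hl).
rewrite eq_leq //; congr h; apply/fsetP => x; apply/idP/imfset2P.
  by move=> xA; exists x => //; exists 1%g; rewrite ?mulg1 //= in_fset1.
by move=> [y /= yA [f /=]]; rewrite in_fset1 => /eqP-> ->; rewrite mulg1.
Qed.

(** Take Q maximal among the sets of c with c F included in S such that the
translates c F, c in Q, are disjoint up to the proportion eps, and let A = Q F.
By maximality every translate c F included in S meets A in at least eps |F|
elements; counting the pairs (c, f) with c f in A, this gives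
eps |E| <= |A| for the set E of all such c in S, which is at least half of S. *)
Lemma almost_disjoint_family (eps : R) F S : 0 < eps < 1 -> F != fset0 ->
  S != fset0 ->
  (forall f, f \in F -> (defect f^-1%g S)%:R <= #|` S|%:R / 2 / #|` F|%:R :> R) ->
  exists Q, let A := fset_mul Q F in
    [/\ (A `<=` S)%fset, (1 - eps) * (#|` Q|%:R * #|` F|%:R) <= #|` A|%:R &
        eps * #|` S|%:R <= 2 * #|` A|%:R].
Proof.
move=> /andP[eps0 eps1] F0 S0 bdS.
have F_gt0 : 0 < #|` F|%:R :> R by rewrite ltr0n lt0n cardfs_eq0.
pose E := [fset c in S | all (fun f => (c * f)%g \in S) F]%fset.
have E_card : #|` S|%:R <= 2 * #|` E|%:R :> R.
  have : (#|` S| <= #|` E| + \sum_(f <- F) defect f^-1%g S)%N.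
    have sub : (S `<=` E `|` \bigcup_(f <- F) fsymdiff (rtrans S f^-1%g) S)%fset.
      apply/fsubsetP => c cS; rewrite in_fsetU !inE /= cS /=.
      case: (boolP (all _ _)) => //= /allPn[f fF cfS].
      apply/bigfcupP; exists f; rewrite ?andbT //.
      by rewrite /fsymdiff !(in_fsetU, in_fsetD, in_rtrans) invgK cS cfS.
    apply: leq_trans (fsubset_leq_card sub) _.
    apply: leq_trans (leq_card_fsetU _ _) _; rewrite leq_add2l.
    elim: (F : seq G) => [|f r ih]; first by rewrite !big_nil cardfs0.
    by rewrite !big_cons; apply: leq_trans (leq_card_fsetU _ _) _; rewrite leq_add2l.
  rewrite -(ler_nat R) natrD natr_sum => SE.
  have : \sum_(f <- F) (defect f^-1%g S)%:R <=
      \sum_(f <- F) (#|` S|%:R / 2 / #|` F|%:R) :> R.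
    by rewrite big_seq [leRHS]big_seq; apply: ler_sum => f; exact: bdS.
  rewrite big_const_seq count_predT iter_addr_0 -[X in _ *+ X]/(#|` F|).
  rewrite -[_ *+ #|` F|]mulr_natr divfK ?gt_eqF //.
  by move: SE; lra.
pose P Q := (Q `<=` E)%fset /\
  (1 - eps) * (#|` Q|%:R * #|` F|%:R) <= #|` fset_mul Q F|%:R.
have exP : exists n, `[< exists2 Q, P Q & #|` Q| = n >].
  exists 0%N; apply/asboolP; exists fset0; rewrite ?cardfs0 //.
  split; first exact: fsub0set.
  by rewrite cardfs0 mul0r mulr0.
have boundP n : `[< exists2 Q, P Q & #|` Q| = n >] -> (n <= #|` E|)%N.
  by move=> /asboolP[Q [QE _] <-]; exact: fsubset_leq_card.
case: (ex_maxnP exP boundP) => n /asboolP[Q [QE PQ] Qn] maxQ.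
exists Q => /=; set A := fset_mul Q F.
have AS : (A `<=` S)%fset.
  apply/fsubsetP => x /imfset2P[c /= cQ [f /= fF ->]].
  by move/fsubsetP/(_ _ cQ): QE; rewrite !inE /= => /andP[_ /allP/(_ _ fF)].
split=> //.
pose N c := count (fun f => (c * f)%g \in A) F.
have N_ge c : c \in E -> eps * #|` F|%:R <= (N c)%:R.
  move=> cE; have [cQ|cQ] := boolP (c \in Q).
    rewrite /N (_ : count _ _ = #|` F|); last first.
      apply/eqP; rewrite -all_count; apply/allP => f fF.
      by apply/imfset2P; exists c => //; exists f.
    by rewrite ler_piMl ?ltW.
  rewrite leNgt; apply/negP => Nlt.
  suff : (n.+1 <= n)%N by rewrite ltnn.
  apply: maxQ; apply/asboolP; exists (c |` Q)%fset; last by rewrite cardfsU1 cQ Qn.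
  split; first by rewrite fsubUset fsub1set cE.
  have cU : (#|` fset_mul (c |` Q)%fset F| + N c = #|` A| + #|` F|)%N.
    rewrite fset_mul1U fsetUC -/A -(card_ltrans c F) -(cardfsUI A (ltrans c F)).
    congr (_ + _)%N; rewrite /N -size_filter.
    rewrite -(card_ltrans c^-1%g (A `&` ltrans c F)%fset).
    apply/perm_size/uniq_perm; rewrite ?fset_uniq ?filter_uniq ?fset_uniq //.
    by move=> x; rewrite in_ltrans in_fsetI in_ltrans invgK mulKg mem_filter.
  move/(congr1 (fun n => n%:R : R)) : cU; rewrite !natrD cardfsU1 cQ add1n -natr1.
  by move: PQ Nlt; rewrite -/A; lra.
have sumN : (\sum_(c <- E) N c <= #|` F| * #|` A|)%N.
  have -> : (\sum_(c <- E) N c = \sum_(f <- F) count (fun c => (c * f)%g \in A) E)%N.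
    under eq_bigr do rewrite /N -sum1_count big_mkcond.
    rewrite exchange_big /=; apply: eq_bigr => f _.
    by rewrite -sum1_count [RHS]big_mkcond.
  have -> : (#|` F| * #|` A| = \sum_(f <- F) #|` A|)%N.
    by rewrite big_const_seq count_predT iter_addn_0 mulnC.
  apply: leq_sum => f _; rewrite -size_filter -(size_map (fun c => c * f)%g).
  apply: uniq_leq_size.
    by rewrite map_inj_uniq ?filter_uniq ?fset_uniq //; exact: mulIg.
  by move=> _ /mapP[c + ->]; rewrite mem_filter => /andP[].
move: sumN; rewrite -(ler_nat R) natr_sum natrM => sumN.
have : \sum_(c <- E) (eps * #|` F|%:R) <= \sum_(c <- E) (N c)%:R :> R.
  by rewrite big_seq [leRHS]big_seq; apply: ler_sum => c; exact: N_ge.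
rewrite big_const_seq count_predT iter_addr_0 => /le_trans /(_ sumN).
rewrite -[X in X <= _]mulr_natr.
rewrite [X in X <= _](_ : _ = #|` F|%:R * (eps * #|` E|%:R)); last first.
  by rewrite mulrAC mulrC.
rewrite ler_pM2l // => EA.
apply: le_trans (_ : eps * (2 * #|` E|%:R) <= _); first by rewrite ler_pM2l.
by rewrite mulrCA ler_pM2l.
Qed.

Definition density_bound (beta : R) :=
  exists K : {fset G}, exists2 eps : R, 0 < eps &
    forall S, right_invariant K eps S -> (h S)%:R <= beta * #|` S|%:R.

(** If nearly invariant sets F with h(F) <= a |F| exist for every precision, the
bound b can be lowered. In a set S invariant enough, an almost disjoint union A
of translates of F has density at least eps / 2, and h(A) is about a |A|. The
rest D of S is either negligible or still invariant enough to apply the bound b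
to it; in both cases h(S) falls below b |S| by a fixed proportion of |S|. *)
Lemma density_bound_improve (a b : R) : 0 <= a < b ->
  (forall e, 0 < e -> density_bound (b + e)) ->
  (forall K eps, 0 < eps ->
     exists2 F, right_invariant K eps F & (h F)%:R <= a * #|` F|%:R) ->
  exists2 kappa, 0 < kappa & density_bound (b - kappa).
Proof.
move=> /andP[a0 ab] hb ha; pose e := b - a.
have e0 : 0 < e by rewrite subr_gt0.
(* with this eps, dividing a by 1 - eps loses at most half of the gap b - a *)
pose eps := e / (2 * (b + 1)).
have b1 : 0 < 2 * (b + 1) by lra.
have eps0 : 0 < eps by rewrite divr_gt0.
have epsE : eps * (2 * (b + 1)) = e by rewrite divfK // gt_eqF.
have eps2 : 2 * eps <= 1.
  rewrite mulrA -[leRHS](@divff _ (2 * (b + 1))) ?gt_eqF //.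
  by rewrite ler_pM2r ?invr_gt0 // /e; lra.
(* the error e2 made on D is at most half of the gain e / 2 made on A, as A has
   density at least eps / 2 *)
pose e2 := eps * e / 8.
have e20 : 0 < e2 by apply: divr_gt0 => //; apply: mulr_gt0.
have [K [d d0 hK]] := hb _ e20.
have C0 : 0 <= C by rewrite ler0n.
(* below the density eta, the trivial bound C |D| on h(D) is harmless *)
pose eta := e / (4 * (C + 1)).
have C1 : 0 < 4 * (C + 1) by lra.
have eta0 : 0 < eta by rewrite divr_gt0.
have etaE : eta * (4 * (C + 1)) = e by rewrite divfK // gt_eqF.
have d1_gt0 : 0 < d * eta / 3 by apply: divr_gt0 => //; apply: mulr_gt0.
set d1 := d * eta / 3 in d1_gt0.
have [F FK hF] := ha K d1 d1_gt0.
have F_gt0 : 0 < #|` F|%:R :> R by rewrite ltr0n lt0n cardfs_eq0; case: FK.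
pose d2 := Num.min d1 (1 / 2 / #|` F|%:R).
have d2_gt0 : 0 < d2 by rewrite lt_min d1_gt0 !divr_gt0.
exists (Num.min (e / 4) e2); first by rewrite lt_min e20 divr_gt0.
exists (K `|` [fset f^-1%g | f in F])%fset, d2 => // S SI.
have [S0 bS] := SI.
have S_gt0 : 0 < #|` S|%:R :> R by rewrite ltr0n lt0n cardfs_eq0.
have eps01 : 0 < eps < 1 by rewrite eps0; lra.
have bF f : f \in F -> (defect f^-1%g S)%:R <= #|` S|%:R / 2 / #|` F|%:R :> R.
  move=> fF; apply: ltW; apply: lt_le_trans (bS _ _) _.
    by rewrite in_fsetU; apply/orP; right; apply/imfsetP; exists f.
  have : d2 <= 1 / 2 / #|` F|%:R by rewrite ge_min lexx orbT.
  by rewrite -(ler_pM2r S_gt0) => /le_trans; apply; rewrite mul1r mulrC mulrA.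
have [Q [AS AQ AS2]] := almost_disjoint_family eps01 FK.1 S0 bF.
set A := fset_mul Q F in AS AQ AS2; pose D := (S `\` A)%fset.
have cardS : #|` S|%:R = #|` A|%:R + #|` D|%:R :> R.
  by rewrite -natrD /D cardfsDS // subnKC // fsubset_leq_card.
have hA : (h A)%:R <= (b - e / 2) * #|` A|%:R.
  have h1 : (h A)%:R <= #|` Q|%:R * (a * #|` F|%:R).
    apply: le_trans (_ : (#|` Q| * h F)%:R <= _).
      by rewrite ler_nat subadditive_fset_mul.
    by rewrite natrM ler_wpM2l.
  apply: le_trans h1 _; rewrite mulrCA.
  have h2 : a <= (b - e / 2) * (1 - eps) by move: epsE eps2; rewrite /e; nra.
  apply: le_trans (_ : (b - e / 2) * (1 - eps) * (#|` Q|%:R * #|` F|%:R) <= _).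
    by rewrite ler_wpM2r // mulr_ge0.
  by rewrite -mulrA ler_wpM2l // /e; lra.
have hS : (h S)%:R <= (h A)%:R + (h D)%:R :> R.
  by rewrite -natrD ler_nat -[in X in (X <= _)%N](fsetID A S) (fsetIidPr AS) hU.
have kE : Num.min (e / 4) e2 <= e / 4 /\ Num.min (e / 4) e2 <= e2.
  by rewrite !ge_min !lexx orbT.
set kappa := Num.min (e / 4) e2 in kE *.
have A_le : #|` A|%:R <= #|` S|%:R :> R by rewrite ler_nat fsubset_leq_card.
have [D_small|D_big] := leP #|` D|%:R (eta * #|` S|%:R).
  have hD : (h D)%:R <= e / 4 * #|` S|%:R.
    apply: le_trans (h_le_card D) _.
    apply: le_trans (_ : C * (eta * #|` S|%:R) <= _); first by rewrite ler_wpM2l.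
    by rewrite mulrA ler_wpM2r //; move: etaE; nra.
  have : (b - e / 2) * #|` A|%:R <= (b - e / 2) * #|` S|%:R.
    by rewrite ler_wpM2l // /e; lra.
  have : kappa * #|` S|%:R <= e / 4 * #|` S|%:R by rewrite ler_wpM2r //; case: kE.
  by move: hS hA hD; rewrite !mulrBl; lra.
have D_gt0 : 0 < #|` D|%:R :> R by apply: le_lt_trans D_big; rewrite mulr_ge0 // ltW.
have DK : right_invariant K d D.
  split=> [|k kK]; first by rewrite -cardfs_eq0 -lt0n -(ltr0n R).
  have bA : (defect k A)%:R <= 2 * d1 * #|` S|%:R.
    have b1A : (defect k A <= #|` Q| * defect k F)%N.
      apply: (@subadditive_fset_mul _ (defect k)) => [|B B'|c B];
        rewrite ?defectU ?defect_ltrans //.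
      rewrite /defect (_ : fsymdiff _ _ = fset0) ?cardfs0 //.
      by apply/fsetP => x; rewrite /fsymdiff !(in_fsetU, in_fsetD, in_rtrans) in_fset0.
    have : (defect k A)%:R <= #|` Q|%:R * (d1 * #|` F|%:R).
      apply: le_trans (_ : (#|` Q| * defect k F)%:R <= _); first by rewrite ler_nat.
      by rewrite natrM ler_wpM2l // ltW //; case: FK => _; apply.
    move/le_trans; apply; rewrite mulrCA.
    have -> : 2 * d1 * #|` S|%:R = d1 * (2 * #|` S|%:R) by rewrite [2 * d1]mulrC mulrA.
    rewrite ler_wpM2l ?ltW //.
    have : 1 / 2 * (#|` Q|%:R * #|` F|%:R) <= (1 - eps) * (#|` Q|%:R * #|` F|%:R).
      by rewrite ler_wpM2r ?mulr_ge0 //; lra.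
    by move: AQ A_le; lra.
  have bSk : (defect k S)%:R < d1 * #|` S|%:R.
    apply: lt_le_trans (bS k _) _; first by rewrite in_fsetU kK.
    by rewrite ler_wpM2r // ge_min lexx.
  have bDk : (defect k D)%:R <= (defect k S)%:R + (defect k A)%:R :> R.
    by rewrite -natrD ler_nat defectD.
  have : d * (eta * #|` S|%:R) < d * #|` D|%:R by rewrite ltr_pM2l.
  by move: bSk bA bDk; rewrite /d1; lra.
have hD := hK _ DK.
have : kappa * #|` S|%:R <= e2 * #|` S|%:R by rewrite ler_wpM2r //; case: kE.
have : e * (eps * #|` S|%:R) <= e * (2 * #|` A|%:R) by rewrite ler_pM2l.
have : e2 * #|` D|%:R <= e2 * #|` S|%:R.
  by rewrite ler_pM2l // cardS lerDr.
move: hS hA hD; rewrite cardS; rewrite /e2; lra.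
Qed.

Lemma folner_right_invariant (F : nat -> {fset G}) K (eps : R) : folner R F ->
  0 < eps -> \forall n \near \oo, right_invariant K eps (F n).
Proof.
move=> [F0 FF] eps0.
suff : \forall n \near \oo, forall k, k \in (K : seq G) ->
    (defect k (F n))%:R < eps * #|` F n|%:R.
  by apply: filterS => n Hn; split.
elim: (K : seq G) => [|g r ih]; first by apply: nearW => n k; rewrite in_nil.
have /cvgrPdist_lt/(_ eps eps0) := FF g.
move: ih; apply: filterS2 => n ih; rewrite sub0r normrN => hg k.
rewrite in_cons => /orP[/eqP->|]; last exact: ih.
rewrite -ltr_pdivrMr ?ltr0n ?lt0n ?cardfs_eq0 ?F0 //.
by apply: le_lt_trans hg; exact: ler_norm.
Qed.

(** The limit b is the infimum of the asymptotic bounds. If h(F n) / |F n| were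
below b - e for infinitely many n, [density_bound_improve] would contradict the
choice of b. *)
Lemma ornstein_weiss (F : nat -> {fset G}) : folner R F ->
  exists b : R, [/\ 0 <= b,
    (fun n => (h (F n))%:R / #|` F n|%:R) @ \oo --> b &
    forall e, 0 < e -> density_bound (b + e)].
Proof.
move=> FF; have F_gt0 n : 0 < #|` F n|%:R :> R by rewrite ltr0n lt0n cardfs_eq0; case: FF.
pose B := [set beta | density_bound beta].
have B_ge0 beta : B beta -> 0 <= beta.
  move=> [K [eps eps0 hK]].
  have [n _ /(_ n (leqnn n))/hK] := folner_right_invariant K FF eps0.
  by move=> /(le_trans (ler0n _ _)); rewrite pmulr_lge0.
have infB : has_inf B.
  split; last by exists 0 => x /B_ge0.
  by exists C, fset0, 1 => // S _; exact: h_le_card.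
exists (inf B); have b0 : 0 <= inf B by apply: lb_le_inf => [|x /B_ge0 //]; case: infB.
have dB e : 0 < e -> density_bound (inf B + e).
  move=> e0; have [beta [K [eps eps0 hK]] be] := inf_adherent e0 infB.
  exists K, eps => // S /hK /le_trans; apply; by rewrite ler_wpM2r // ltW.
split=> //; apply/cvgrPdist_le => e e0; apply: contrapT => not_cvg.
have [K [eps eps0 hK]] := dB e e0.
have upper : \forall n \near \oo, (h (F n))%:R / #|` F n|%:R <= inf B + e.
  apply: filterS (folner_right_invariant K FF eps0) => n /hK.
  by rewrite ler_pdivrMr.
have often K' eps' : 0 < eps' ->
    exists2 n, right_invariant K' eps' (F n) & (h (F n))%:R / #|` F n|%:R < inf B - e.
  move=> eps'0; apply: contrapT => h'; apply: not_cvg.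
  move: upper (folner_right_invariant K' FF eps'0); apply: filterS2 => n up inv.
  rewrite ler_distlC up andbT leNgt; apply/negP => lo.
  by apply: h'; exists n.
have [n0 _ lo0] := often fset0 1 ltr01.
have ab : 0 <= inf B - e < inf B.
  rewrite ltrBlDr ltrDl e0 andbT; apply: le_trans (ltW lo0).
  by rewrite divr_ge0.
have [K' eps' eps'0|kappa kappa0 Bk] := density_bound_improve ab dB.
  have [n inv lo] := often K' eps' eps'0; exists (F n) => //.
  by rewrite -ler_pdivrMr // ltW.
have : inf B <= inf B - kappa by apply: ge_inf Bk; case: infB.
by rewrite lerBrDr gerDl leNgt kappa0.
Qed.

End OrnsteinWeiss.

(** * From finitely additive means to Borel measures *)

(** Finitely additive probabilities defined on all subsets. *)
Record mean (R : realType) (X : Type) := Mean {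
  mean_fun :> set X -> R;
  mean_ge0 : forall A, 0 <= mean_fun A;
  mean_setT : mean_fun setT = 1;
  mean_setU : forall A B, A `&` B = set0 ->
    mean_fun (A `|` B) = mean_fun A + mean_fun B }.

Section Means.
Context (R : realType) (X : Type) (nu : mean R X).
Implicit Types A B : set X.

Lemma mean_set0 : nu set0 = 0.
Proof.
have := mean_setU nu (setI0 set0); rewrite setU0.
by move/(congr1 (fun r => r - nu set0)); rewrite subrr addrK => ->.
Qed.

Lemma mean_le A B : A `<=` B -> nu A <= nu B.
Proof.
move=> AB; rewrite -(setDUK AB) mean_setU ?lerDl ?mean_ge0 //.
by rewrite setDE setICA setICr setI0.
Qed.

Lemma mean_setU_le A B : nu (A `|` B) <= nu A + nu B.
Proof.
rewrite (_ : A `|` B = A `|` (B `\` A)); last first.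
  apply/seteqP; split=> x [Ax|Bx]; try by left.
    by have [Ax|nAx] := pselect (A x); [left|right].
  by right; case: Bx.
rewrite mean_setU; last by rewrite setDE setICA setICr setI0.
by rewrite lerD2l; apply: mean_le; apply: subIsetl.
Qed.

Lemma mean_bigcup_le (F : nat -> set X) n :
  nu (\big[setU/set0]_(i < n) F i) <= \sum_(i < n) nu (F i).
Proof.
elim: n => [|n ih]; first by rewrite !big_ord0 mean_set0.
rewrite !big_ord_recr /=; apply: le_trans (mean_setU_le _ _) _.
by rewrite lerD2r.
Qed.

End Means.

(** A mean nu on a compact metric space has a regularization: the measure of an
open set is the supremum of nu over its closed subsets, and the measure of any
set is the infimum over its open supersets. *)
Section InnerOuter.
Context (R : realType) (X : metricType R) (nu : mean R X).
Hypothesis Xcompact : compact [set: X].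
Local Open Scope ereal_scope.
Implicit Types A K O P : set X.

Definition inner O : \bar R :=
  ereal_sup [set (nu K)%:E | K in [set K | closed K /\ K `<=` O]].

Definition outer A : \bar R :=
  ereal_inf [set inner O | O in [set O | open O /\ A `<=` O]].

Lemma le_inner K O : closed K -> K `<=` O -> (nu K)%:E <= inner O.
Proof. by move=> cK KO; apply: ereal_sup_ubound; exists K. Qed.

Lemma inner_ge0 O : 0 <= inner O.
Proof.
by have := @le_inner set0 O closed0 (@sub0set _ _); rewrite mean_set0.
Qed.

Lemma inner_le1 O : inner O <= 1.
Proof.
apply: ge_ereal_sup => _ [K _ <-]; have := mean_le nu (@subsetT _ K).
by rewrite mean_setT -lee_fin.
Qed.

Lemma inner_mono O P : O `<=` P -> inner O <= inner P.
Proof.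
move=> OP; apply: ge_ereal_sup => _ [K [cK KO] <-].
by apply: le_inner => //; exact: subset_trans OP.
Qed.

Lemma outer_open O : open O -> outer O = inner O.
Proof.
move=> oO; apply/eqP; rewrite eq_le; apply/andP; split.
  by apply: ereal_inf_lbound; exists O => //; split.
by apply: le_ereal_inf_tmp => _ [P [oP OP] <-]; exact: inner_mono.
Qed.

Lemma outer_ge0 A : 0 <= outer A.
Proof. by apply: le_ereal_inf_tmp => _ [P _ <-]; exact: inner_ge0. Qed.

Lemma outer_mono A B : A `<=` B -> outer A <= outer B.
Proof.
move=> AB; apply: le_ereal_inf_tmp => _ [P [oP BP] <-].
by apply: ereal_inf_lbound; exists P => //; split=> //; exact: subset_trans BP.
Qed.

Lemma outer_fin A : outer A \is a fin_num.
Proof.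
rewrite ge0_fin_numE ?outer_ge0 // (@le_lt_trans _ _ (inner setT)) //.
  by rewrite -(outer_open openT); exact: outer_mono.
by rewrite (le_lt_trans (inner_le1 _)) // ltry.
Qed.

Lemma outer_set0 : outer set0 = 0.
Proof.
apply/eqP; rewrite eq_le outer_ge0 andbT (outer_open open0).
by apply: ge_ereal_sup => _ [K [_ + ] <-]; rewrite subset0 => ->; rewrite mean_set0.
Qed.

Lemma outer_setT : outer setT = 1.
Proof.
rewrite (outer_open openT); apply/eqP; rewrite eq_le inner_le1 /=.
by have := @le_inner setT setT closedT (@subset_refl _ _); rewrite mean_setT.
Qed.

(** Mass can only flow to a closed set in the regularization. This one-sided
comparison replaces weak convergence of measures. *)
Lemma mean_le_outer K : closed K -> (nu K)%:E <= outer K.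
Proof. by move=> cK; apply: le_ereal_inf_tmp => _ [P [_ KP] <-]; exact: le_inner. Qed.

(** A compact set covered by open sets O_n is covered by finitely many closed
subsets of the O_n. The same N bounds the number of sets and the depth. *)
Lemma closed_bigcup_depth (O : nat -> set X) K : closed K ->
  (forall n, open (O n)) -> K `<=` \bigcup_n O n ->
  exists N, K `<=` \big[setU/set0]_(n < N) [set x | (N%:R^-1 <= depth (O n) x)%R].
Proof.
move=> cK oO KO.
have cptK : compact K by apply: (subclosed_compact cK Xcompact).
suff : \forall N \near \oo, K `<=` fun x =>
    (\big[setU/set0]_(n < N) [set x | (N%:R^-1 <= depth (O n) x)%R]) x.
  by move=> [N _ /(_ N (leqnn N)) h]; exists N.
apply: (iffLR (compact_near_coveringP K) cptK nat \oo (fun N x => 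
  (\big[setU/set0]_(n < N) [set x | (N%:R^-1 <= depth (O n) x)%R]) x)) => x Kx.
have [n _ Onx] := KO x Kx.
have d0 : (0 < depth (O n) x)%R by apply/depth_gt0P.
have near1 : \forall y \near x, (depth (O n) x / 2 < depth (O n) y)%R.
  have := @depth_continuous _ _ (O n) x => /cvgr_gt; apply.
  by rewrite gtr_pMr //; lra.
have near2 : \forall N \near \oo, (n < N)%N /\ (N%:R^-1 <= depth (O n) x / 2)%R.
  apply: filterS2 (nbhs_infty_gt n) (nbhs_infty_gtr (depth (O n) x / 2)^-1) => N nN hN.
  split=> //; have d2 : (0 < depth (O n) x / 2)%R by rewrite divr_gt0.
  rewrite -[leRHS]invrK lef_pV2 ?posrE ?invr_gt0 // ?ltW //.
  by apply: lt_trans hN; rewrite invr_gt0.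
exists ([set y | (depth (O n) x / 2 < depth (O n) y)%R],
        [set N | (n < N)%N /\ (N%:R^-1 <= depth (O n) x / 2)%R]); first by split.
move=> [y N] /= [hy [nN hN]].
suff : (\bigcup_(k in `I_N) [set z | (N%:R^-1 <= depth (O k) z)%R]) y.
  by rewrite bigcup_mkord.
exists n => //=.
by apply: le_trans hN (ltW hy).
Qed.

Lemma closed_depth_ge A r : closed [set x | (r <= depth A x)%R].
Proof.
rewrite [X in closed X](_ : _ = ~` [set x | (depth A x < r)%R]).
  apply: open_closedC; apply: open_lt_continuous; first exact: depth_continuous.
  by move=> x; exact: cvg_cst.
by apply/seteqP; split=> x /=; rewrite leNgt => /negP.
Qed.

Lemma inner_bigcup (O : nat -> set X) : (forall n, open (O n)) ->
  inner (\bigcup_n O n) <= \sum_(0 <= n <oo) inner (O n).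
Proof.
move=> oO; apply: ge_ereal_sup => _ [K [cK KO] <-].
have [N KN] := closed_bigcup_depth cK oO KO.
apply: le_trans (_ : \sum_(0 <= n < N) inner (O n) <= _); last first.
  by apply: nneseries_lim_ge => n _ _; exact: inner_ge0.
rewrite big_mkord.
apply: le_trans (_ : (\sum_(n < N) nu [set x | (N%:R^-1 <= depth (O n) x)%R])%:E <= _).
  rewrite lee_fin; apply: le_trans (mean_le nu KN) _.
  exact: (mean_bigcup_le nu (fun n => [set x | (N%:R^-1 <= depth (O n) x)%R])).
rewrite -sumEFin; apply: lee_sum => n _; apply: le_inner; first exact: closed_depth_ge.
move=> x /= h; apply/depth_gt0P => //; apply: lt_le_trans h.
by rewrite invr_gt0 ltr0n; case: n => n /=; exact: leq_ltn_trans.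
Qed.

Lemma outer_sigma_subadditive : sigma_subadditive outer.
Proof.
move=> F; apply/lee_addgt0Pr => e e0.
have hO n : exists P, [/\ open P, F n `<=` P &
    inner P <= outer (F n) + (e / (2 ^ n.+1)%:R)%:E].
  have en : (0 < e / (2 ^ n.+1)%:R)%R by rewrite divr_gt0 // ltr0n expn_gt0.
  have [_ [P [oP FP] <-] h] := lb_ereal_inf_adherent en (outer_fin (F n)).
  by exists P; split=> //; exact: ltW.
have [U OP] := choice hO.
apply: le_trans (_ : outer (\bigcup_n U n) <= _).
  by apply: outer_mono; apply: subset_bigcup => n _; case: (OP n).
rewrite outer_open; last by apply: bigcup_open => n _; case: (OP n).
apply: le_trans (inner_bigcup _) _; first by move=> n; case: (OP n).
apply: le_trans (epsilon_trick xpredT _ (ltW e0)); last by move=> n; exact: outer_ge0.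
by apply: lee_nneseries => n *; [exact: inner_ge0|case: (OP n)].
Qed.

(** For A contained in an open P, the set P can be filled by a closed subset K
of its intersection with O, then by a closed subset of P minus K; these are
disjoint and the second set contains the rest of A. *)
Lemma open_caratheodory_le O A : open O ->
  outer (A `&` O) + outer (A `&` ~` O) <= outer A.
Proof.
move=> oO; apply: le_ereal_inf_tmp => _ [P [oP AP] <-].
apply: le_trans (_ : inner (P `&` O) + outer (P `&` ~` O) <= _).
  rewrite -outer_open; last exact: openI.
  by apply: leeD; apply: outer_mono; exact: setSI.
rewrite -leeBrDr ?outer_fin //; apply: ge_ereal_sup => _ [K [cK KPO] <-].
rewrite leeBrDr ?outer_fin // addeC -leeBrDr //.
have oPK : open (P `&` ~` K) by apply: openI => //; exact: closed_openC.
apply: le_trans (_ : inner (P `&` ~` K) <= _).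
  rewrite -(outer_open oPK); apply: outer_mono => x [Px nOx]; split=> // Kx.
  by have [] := KPO x Kx.
apply: ge_ereal_sup => _ [L [cL LPK] <-]; rewrite leeBrDr // addeC -EFinD.
rewrite -mean_setU; last by apply/seteqP; split=> // x [Kx /LPK[_]].
apply: le_inner; first exact: closedU.
by move=> x [/KPO[]|/LPK[]].
Qed.

End InnerOuter.

Section Law.
Context (R : realType) (X : metricType R) (nu : mean R X).
Hypothesis Xcompact : compact [set: X].
Context (x0 : X).

Let mu (A : set (pointed_at x0)) : \bar R := outer nu A.

HB.instance Definition _ := isOuterMeasure.Build R (pointed_at x0) mu
  (outer_set0 nu) (outer_ge0 nu) (@outer_mono _ _ nu)
  (outer_sigma_subadditive nu Xcompact).

Let borel_caratheodory (A : set (borel x0)) : measurable A ->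
  mu.-caratheodory A.
Proof.
apply: smallest_sub A.
  split; first exact: caratheodory_measurable_set0.
    by move=> A; rewrite setTD; exact: caratheodory_measurable_setC.
  by move=> A; exact: caratheodory_measurable_bigcup.
by move=> O oO; apply: le_caratheodory_measurable => A; exact: open_caratheodory_le.
Qed.

Definition mean_law (A : set (borel x0)) : \bar R := outer nu A.

Let mean_law0 : mean_law set0 = 0%E. Proof. exact: outer_set0. Qed.

Let mean_law_ge0 A : (0 <= mean_law A)%E. Proof. exact: outer_ge0. Qed.

Let mean_law_sigma_additive : semi_sigma_additive mean_law.
Proof.
move=> A mA tA mUA; apply: (@caratheodory_measure_sigma_additive R _ mu) => //.
  by move=> i; exact: borel_caratheodory.
exact: borel_caratheodory.
Qed.

HB.instance Definition _ := isMeasure.Build _ _ _ mean_law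
  mean_law0 mean_law_ge0 mean_law_sigma_additive.

HB.instance Definition _ := Measure_isProbability.Build _ _ _ mean_law
  (outer_setT nu).

Definition mean_probability : probability (borel x0) R := mean_law.

End Law.

Section Invariance.
Context (R : realType) (X : metricType R) (nu : mean R X).

Let outer_homeo_le (f f' : X -> X) A : continuous f -> continuous f' ->
  cancel f f' -> cancel f' f -> (forall B, nu (f @^-1` B) = nu B) ->
  (outer nu (f @^-1` A) <= outer nu A)%E.
Proof.
move=> cf cf' fK f'K nuf; apply: le_ereal_inf_tmp => _ [P [oP AP] <-].
have oP' : open (f @^-1` P) by apply: open_comp.
apply: le_trans (_ : outer nu (f @^-1` P) <= _)%E.
  by apply: outer_mono => x /AP.
rewrite outer_open //; apply: ge_ereal_sup => _ [K [cK KP] <-].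
have cK' : closed (f' @^-1` K) by apply: closed_comp.
rewrite (_ : K = f @^-1` (f' @^-1` K)); last first.
  by apply/seteqP; split=> x /=; rewrite fK.
by rewrite nuf; apply: le_inner => // x /= /KP /=; rewrite f'K.
Qed.

Lemma outer_homeo (f : X -> X) A : homeomorphism f ->
  (forall B, nu (f @^-1` B) = nu B) -> outer nu (f @^-1` A) = outer nu A.
Proof.
move=> [cf [f' [cf' fK f'K]]] nuf; apply/eqP; rewrite eq_le; apply/andP; split.
  exact: (outer_homeo_le (f' := f')).
rewrite {1}(_ : A = f' @^-1` (f @^-1` A)); last first.
  by apply/seteqP; split=> x /=; rewrite f'K.
apply: (outer_homeo_le (f' := f)) => // B.
rewrite -nuf; congr (nu _).
by apply/seteqP; split=> x /=; rewrite fK.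
Qed.

End Invariance.

Lemma invariant_probability_of_mean (R : realType) (G : groupType)
    (X : metricType R) (T : G -> X -> X) (nu : mean R X) (x0 : X) :
  compact [set: X] -> dynamical_system T ->
  (forall g A, nu (T g @^-1` A) = nu A) ->
  exists mu : invariant_probability T,
    forall K, closed K -> ((nu K)%:E <= law mu K)%E.
Proof.
move=> Xc [Th _] nuT.
have inv (g : G) (A : set (borel x0)) : measurable A ->
    mean_probability nu Xc x0 (T g @^-1` A) = mean_probability nu Xc x0 A.
  by move=> _; exact: outer_homeo.
exists (InvariantProbability inv) => K cK; exact: mean_le_outer.
Qed.

(** * Empirical means along a Folner sequence *)

(** The limit is the infimum of the r such that f <= r along U. *)
Lemma ultra_limit (R : realType) (I : Type) (U : set_system I) (f : I -> R) :
  UltraFilter U -> (forall i, 0 <= f i <= 1) -> exists l : R, f @ U --> l.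
Proof.
move=> UU f01; pose E := [set r | U [set i | f i <= r]].
have infE : has_inf E.
  split; first by exists 1; apply: filterE => i; case/andP: (f01 i).
  exists 0 => r Er; have [i /= fi] := filter_ex Er.
  by apply: le_trans fi; case/andP: (f01 i).
exists (inf E); apply/cvgrPdist_le => e e0.
have up : U [set i | f i <= inf E + e].
  have [r Er re] := inf_adherent e0 infE.
  by apply: filterS Er => i /= /le_trans; apply; exact: ltW.
have lo : U (~` [set i | f i <= inf E - e]).
  have [bad|//] := in_ultra_setVsetC [set i | f i <= inf E - e] UU.
  have : inf E <= inf E - e by apply: ge_inf => //; case: infE.
  by rewrite lerBrDr gerDl leNgt e0.
move: up lo; apply: filterS2 => i /= up /negP; rewrite -ltNge => lo.
by rewrite ler_distlC up andbT ltW.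
Qed.

Section EmpiricalMeans.
Context (R : realType) (G : groupType) (X : metricType R) (T : G -> X -> X).
Hypothesis Xcompact : compact [set: X].
Hypothesis Tsystem : dynamical_system T.

Lemma act1 x : T 1%g x = x.
Proof.
have [Th TM] := Tsystem; have [_ [f' [_ fK _]]] := Th 1%g.
by apply: (can_inj fK); have := TM 1%g 1%g; rewrite mulg1 => /(congr1 (@^~ x)).
Qed.

Lemma actM g h x : T (g * h)%g x = T g (T h x).
Proof. by have [_ ->] := Tsystem. Qed.

Lemma actK g : cancel (T g) (T g^-1%g).
Proof. by move=> x; rewrite -actM mulVg act1. Qed.

Lemma actVK g : cancel (T g^-1%g) (T g).
Proof. by move=> x; rewrite -actM mulgV act1. Qed.

Lemma act_continuous g : continuous (T g).
Proof. by have [/(_ g)[]] := Tsystem. Qed.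

Lemma image_act g (A : set X) : T g @` A = T g^-1%g @^-1` A.
Proof.
apply/seteqP; split=> [_ [x Ax <-]|x /= Ax]; first by rewrite /= actK.
by exists (T g^-1%g x) => //; rewrite actVK.
Qed.

(** The inverse agrees with the convention of [mdim]: x lies in T g (A) when
T g^-1 (x) lies in A. *)
Definition visits (S : {fset G}) (x : X) (A : set X) : nat :=
  count (fun g => T g^-1%g x \in A) S.

Lemma visits_setU S x A B : A `&` B = set0 ->
  visits S x (A `|` B) = (visits S x A + visits S x B)%N.
Proof.
move=> AB; rewrite /visits -count_predUI -[LHS]addn0; congr (_ + _)%N.
  by apply: eq_count => g; rewrite in_setU.
apply/esym/eqP; rewrite -leqn0 leqNgt -has_count; apply/hasPn => g _ /=.
by apply/negP; rewrite -in_setI AB in_set0.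
Qed.

(** Moving A by T h amounts to translating S by h^-1 on the right. *)
Lemma visits_preimage S x h A :
  (visits S x (T h @^-1` A) <= visits S x A + defect h^-1%g S)%N /\
  (visits S x A <= visits S x (T h @^-1` A) + defect h^-1%g S)%N.
Proof.
have -> : visits S x (T h @^-1` A) = visits (rtrans S h^-1%g) x A.
  rewrite /visits; set p := fun g => T g^-1%g x \in A.
  rewrite (@eq_count _ _ (fun g => p (g * h^-1)%g)); last first.
    move=> g; rewrite /p invgM invgK actM; apply/idP/idP; rewrite !inE //.
  rewrite -count_map; apply/seq.permP/uniq_perm; rewrite ?fset_uniq //.
    by rewrite map_inj_uniq ?fset_uniq //; exact: mulIg.
  move=> g; rewrite in_rtrans; apply/mapP/idP => [[k kS ->]|gS].
    by rewrite mulgK.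
  by exists (g * h^-1^-1)%g => //; rewrite mulgVK.
have cmp (A1 A2 : {fset G}) p : (count p A1 <= count p A2 + #|` (A1 `\` A2)%fset|)%N.
  rewrite -!size_filter -size_cat; apply: uniq_leq_size.
    by rewrite filter_uniq ?fset_uniq.
  move=> g; rewrite mem_cat !mem_filter in_fsetD => /andP[-> ->] /=.
  by rewrite andbT orbN.
have le1 (A1 A2 : {fset G}) : (#|` (A1 `\` A2)%fset| <= #|` fsymdiff A1 A2|)%N.
  by apply: fsubset_leq_card; exact: fsubsetUl.
have le2 (A1 A2 : {fset G}) : (#|` (A2 `\` A1)%fset| <= #|` fsymdiff A1 A2|)%N.
  by apply: fsubset_leq_card; exact: fsubsetUr.
split; apply: leq_trans (cmp _ _ _) (leq_add (leqnn _) _); [exact: le1|exact: le2].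
Qed.

Lemma sum_mult_visits (S : {fset G}) x (L : seq (set X)) :
  (\sum_(g <- S) mult L (T g^-1%g x) = \sum_(A <- L) visits S x A)%N.
Proof.
under eq_bigr do rewrite /mult -sum1_count big_mkcond.
rewrite exchange_big; apply: eq_bigr => A _.
by rewrite /visits -sum1_count [RHS]big_mkcond.
Qed.

(** The limit, along an ultrafilter on the indices n where the sums are large,
of the empirical means of the finite orbit pieces of the points x_n is an invariant
mean, by the Folner property; its regularization is the measure wanted. *)
Lemma empirical_limit (F : nat -> {fset G}) (Ks : seq (set X)) (c : R) :
  folner R F -> (forall K, K \in Ks -> closed K) ->
  (forall N, exists2 n, (N <= n)%N & exists x,
     c * #|` F n|%:R <= (\sum_(g <- F n) mult Ks (T g^-1%g x))%:R) ->
  exists mu : invariant_probability T, (c%:E <= \sum_(K <- Ks) law mu K)%E.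
Proof.
move=> FF Kc often; have F_gt0 n : 0 < #|` F n|%:R :> R.
  by rewrite ltr0n lt0n cardfs_eq0; case: FF.
have [_ _ [x0 _]] := often 0%N.
pose P n x := c * #|` F n|%:R <= (\sum_(g <- F n) mult Ks (T g^-1%g x))%:R.
have /choice[x xP] : forall n, exists y, (exists z, P n z) -> P n y.
  move=> n; have [[y Py]|nP] := pselect (exists y, P n y); first by exists y.
  by exists x0 => /nP.
pose D := [set n | P n (x n)].
have [U [UU DU]] : exists U, UltraFilter U /\ within D \oo `<=` U.
  apply: ultraFilterLemma; apply: Build_ProperFilter => -[N _ /= ND].
  by have [n Nn /xP Pn] := often N; exact: (ND n).
have U_infty (Q : set nat) : (\forall n \near \oo, Q n) -> U Q.
  by move=> hQ; apply: DU; apply: filterS hQ => n Qn _.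
have UD : U D by apply: DU; apply: nearW.
pose dens n A : R := (visits (F n) (x n) A)%:R / #|` F n|%:R.
have dens01 A n : 0 <= dens n A <= 1.
  by rewrite divr_ge0 //= ler_pdivrMr // mul1r ler_nat count_size.
have /choice[nu dnu] : forall A, exists l : R, dens ^~ A @ U --> l.
  by move=> A; exact: (ultra_limit UU (dens01 A)).
have lim_uniq A l : dens ^~ A @ U --> l -> nu A = l.
  move=> h; exact: (cvg_unique (@Rhausdorff R) (dnu A) h).
have nu_ge0 A : 0 <= nu A.
  by apply: (cvgr_to_ge (dnu A)); apply: nearW => n; case/andP: (dens01 A n).
have nuT : nu setT = 1.
  apply: lim_uniq; rewrite [X in X @ _ --> _](_ : _ = cst 1); first exact: cvg_cst.
  apply/funext => n; rewrite /dens /visits (eq_count (a2 := predT)) => [|g].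
    by rewrite count_predT divff // gt_eqF.
  by rewrite in_setT.
have nuU A B : A `&` B = set0 -> nu (A `|` B) = nu A + nu B.
  move=> AB; apply: lim_uniq.
  rewrite [X in X @ _ --> _](_ : _ = dens ^~ A \+ dens ^~ B); first exact: cvgD.
  by apply/funext => n; rewrite /dens visits_setU //= natrD mulrDl.
pose m := Mean nu_ge0 nuT nuU.
have mT g A : m (T g @^-1` A) = m A.
  apply: lim_uniq.
  rewrite [X in X @ _ --> _](_ : _ = dens ^~ A \+
    (fun n => dens n (T g @^-1` A) - dens n A)); last first.
    by apply/funext => n /=; rewrite addrC subrK.
  rewrite -[m A]addr0; apply: cvgD; first exact: dnu.
  apply/cvgrPdist_le => e e0; apply: U_infty.
  apply: filterS (folner_right_invariant [fset g^-1%g]%fset FF e0) => n [_ /(_ g^-1%g)].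
  rewrite in_fset1 eqxx => /(_ isT) hb.
  rewrite sub0r normrN /dens -mulrBl normrM [X in _ * X]ger0_norm ?invr_ge0 //.
  rewrite ler_pdivrMr // (le_trans _ (ltW hb)) //.
  have [] := visits_preimage (F n) (x n) g A; rewrite -!(ler_nat R) !natrD => h1 h2.
  by rewrite ler_norml; lra.
have [mu muP] := invariant_probability_of_mean x0 Xcompact Tsystem mT.
exists mu; apply: le_trans (_ : (\sum_(K <- Ks) m K)%:E <= _)%E; last first.
  rewrite -sumEFin big_seq [leRHS]big_seq; apply: lee_sum => K KK.
  by apply: muP; exact: Kc.
rewrite lee_fin.
have cvgS : (fun n => \sum_(K <- Ks) dens n K) @ U --> \sum_(K <- Ks) m K.
  by apply: cvg_big => [|K _]; [exact: add_continuous|exact: dnu].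
apply: (cvgr_to_ge cvgS); apply: filterS UD => n.
rewrite /D /P /= sum_mult_visits -ler_pdivlMr // => /le_trans; apply.
by rewrite natr_sum mulr_suml.
Qed.

End EmpiricalMeans.

(** * Multiplicities and integrals *)

Section Ord.
Context (R : realType) (X : topologicalType).

Lemma sum_indic_mult (L : seq (set X)) x :
  \sum_(A <- L) (\1_A x : R) = (mult L x)%:R.
Proof.
rewrite /mult -sum1_count natr_sum [RHS]big_mkcond; apply: eq_bigr => A _.
by rewrite indicE; case: (x \in A).
Qed.

Lemma set_undup (L : seq (set X)) : [set` undup L] = [set` L].
Proof. by apply/seteqP; split=> A /=; rewrite mem_undup. Qed.

Lemma ord_seq (L : seq (set X)) x : uniq L ->
  ord R [set` L] x = (mult L x)%:R - 1.
Proof.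
by move=> uL; rewrite /ord -sum_indic_mult (fsbig_seq _ _ uL) addrC.
Qed.

Lemma ord_seq_le (L : seq (set X)) x : ord R [set` L] x <= (mult L x)%:R - 1.
Proof.
by rewrite -set_undup ord_seq ?undup_uniq // lerB // ler_nat count_undup.
Qed.

End Ord.

Section SeqCovers.
Context (X : topologicalType).
Implicit Types L : seq (set X).

Lemma open_seq_undup L : open_seq L -> open_seq (undup L).
Proof. by move=> oL A; rewrite mem_undup => /oL. Qed.

Lemma covering_undup L : covering L -> covering (undup L).
Proof. by move=> cL x; have [A AL Ax] := cL x; exists A; rewrite ?mem_undup. Qed.

Lemma finite_open_cover_seq L : open_seq L -> covering L ->
  finite_open_cover [set` L].
Proof.
move=> oL cL; split; [exact: finite_seq|exact: oL|].
by apply/seteqP; split=> // x _; have [A AL Ax] := cL x; exists A.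
Qed.

Lemma finite_open_cover_enum (C : set (set X)) : finite_open_cover C ->
  exists L, [/\ uniq L, C = [set` L], open_seq L & covering L].
Proof.
move=> [/finite_seqP[L ->] oC cC]; exists (undup L).
rewrite undup_uniq set_undup; split=> //; first exact: open_seq_undup.
apply: covering_undup => x; have : [set: X] x by [].
by rewrite -cC => -[A /= AL Ax]; exists A.
Qed.

End SeqCovers.

Section Probabilities.
Context (R : realType) (G : groupType) (X : metricType R) (T : G -> X -> X).
Hypothesis Tsystem : dynamical_system T.
Implicit Types (mu : invariant_probability T) (L M : seq (set X)).

(** The values of an invariant measure as real numbers; this is faithful on
measurable sets only. *)
Definition prob mu (A : set X) : R := fine (law mu A).

Lemma probE mu (A : set (borel (base_point mu))) : measurable A ->
  (prob mu A)%:E = law mu A.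
Proof. by move=> mA; rewrite /prob fineK // fin_num_measure. Qed.

Lemma prob_ge0 mu A : 0 <= prob mu A.
Proof. by rewrite fine_ge0. Qed.

Lemma open_borel_measurable (x0 : X) (A : set (borel x0)) :
  open (A : set X) -> measurable A.
Proof. by move=> oA; apply: sub_sigma_algebra. Qed.

Lemma closed_borel_measurable (x0 : X) (A : set (borel x0)) :
  closed (A : set X) -> measurable A.
Proof.
move=> cA; rewrite -[A]setCK; apply: measurableC.
by apply: open_borel_measurable; exact: closed_openC.
Qed.

Definition borel_seq mu L :=
  forall A, A \in L -> measurable (A : set (borel (base_point mu))).

Lemma borel_seq_open mu L : open_seq L -> borel_seq mu L.
Proof. by move=> oL A /oL; exact: open_borel_measurable. Qed.

Lemma prob_act mu g A : open A -> prob mu (T g @` A) = prob mu A.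
Proof.
move=> oA; rewrite (image_act Tsystem) /prob law_invariant //.
exact: open_borel_measurable.
Qed.

Lemma mult_cons A L x :
  ((mult (A :: L) x)%:R : R) = \1_A x + (mult L x)%:R.
Proof. by rewrite -!sum_indic_mult big_cons. Qed.

Lemma measurable_mult mu L : borel_seq mu L ->
  measurable_fun [set: borel (base_point mu)] (fun x => (mult L x)%:R : R).
Proof.
elim: L => [|A L ih] mL; first exact: measurable_cst.
under eq_fun do rewrite mult_cons.
apply: measurable_funD.
  by apply: measurable_indic; apply: mL; rewrite mem_head.
by apply: ih => B BL; apply: mL; rewrite in_cons BL orbT.
Qed.

Lemma integral_mult mu L : borel_seq mu L ->
  (\int[law mu]_x ((mult L x)%:R : R)%:E = (\sum_(A <- L) prob mu A)%:E)%E.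
Proof.
elim: L => [|A L ih] mL; first by rewrite big_nil integral0.
have mA : measurable (A : set (borel (base_point mu))) by apply: mL; rewrite mem_head.
have mL' : borel_seq mu L by move=> B BL; apply: mL; rewrite in_cons BL orbT.
under eq_integral do rewrite mult_cons EFinD.
rewrite ge0_integralD //.
- by rewrite ih // integral_indic // setIT big_cons EFinD probE.
- by apply/measurable_EFinP; exact: measurable_indic.
- by apply/measurable_EFinP; exact: measurable_mult.
Qed.

(** All comparisons of measures below come from comparing multiplicities at
every point, and integrating. *)
Lemma sum_prob_le mu (c : R) L M : borel_seq mu L -> borel_seq mu M -> 0 <= c ->
  (forall x, (mult L x)%:R <= c * (mult M x)%:R) ->
  \sum_(A <- L) prob mu A <= c * \sum_(A <- M) prob mu A.
Proof.
move=> mL mM c0 LM; rewrite -lee_fin EFinM -!integral_mult //.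
rewrite -ge0_integralZl_EFin //; last by apply/measurable_EFinP; exact: measurable_mult.
apply: ge0_le_integral => //.
- by apply/measurable_EFinP; exact: measurable_mult.
- by apply: measurable_funeM; apply/measurable_EFinP; exact: measurable_mult.
- by move=> x _; rewrite -EFinM lee_fin.
Qed.

Lemma prob_setT mu : prob mu setT = 1.
Proof. by rewrite /prob probability_setT. Qed.

Lemma sum_prob_le_cst mu (c : R) L : borel_seq mu L -> 0 <= c ->
  (forall x, (mult L x)%:R <= c) -> \sum_(A <- L) prob mu A <= c.
Proof.
move=> mL c0 Lc; have := @sum_prob_le mu c L [:: setT] mL.
rewrite big_seq1 prob_setT mulr1; apply => // [A|x].
  by rewrite inE => /eqP ->; exact: measurableT.
rewrite mult_cons indicE in_setT /mult /= addr0 mulr1. exact: Lc.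
Qed.

Lemma integral_ord mu L : uniq L -> open_seq L -> covering L ->
  (\int[law mu]_x (ord R [set` L] x)%:E = (\sum_(A <- L) prob mu A - 1)%:E)%E.
Proof.
move=> uL oL cL; have mL := @borel_seq_open mu _ oL.
have mu1 : law mu setT = 1%E by exact: probability_setT.
have mult0 x : 0 <= (mult L x)%:R - 1 :> R.
  by rewrite subr_ge0 ler1n covering_mult_gt0.
have : (\int[law mu]_x (ord R [set` L] x)%:E + 1 = (\sum_(A <- L) prob mu A)%:E)%E.
  rewrite -integral_mult // -mu1 -[law mu setT]mul1e -integral_cst //.
  rewrite -ge0_integralD //.
  - by apply: eq_integral => x _; rewrite ord_seq // -EFinD subrK.
  - by move=> x _; rewrite ord_seq // lee_fin.
  - under eq_fun do rewrite ord_seq //.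
    apply/measurable_EFinP; apply: measurable_funB => //.
    by exact: measurable_mult.
by move=> h; rewrite EFinB -h addeK.
Qed.

Lemma integral_ord_le mu L : open_seq L -> covering L ->
  (\int[law mu]_x (ord R [set` L] x)%:E <= (\sum_(A <- L) prob mu A - 1)%:E)%E.
Proof.
move=> oL cL; have oU := open_seq_undup oL.
rewrite -set_undup integral_ord ?undup_uniq //; last exact: covering_undup.
rewrite lee_fin lerD2r -[leRHS]mul1r.
apply: sum_prob_le => // [||x]; try exact: borel_seq_open.
by rewrite mul1r ler_nat count_undup.
Qed.

End Probabilities.

(** * Least orders of refinements of joins *)

Section Orders.
Context (R : realType) (G : groupType) (X : metricType R) (T : G -> X -> X).
Hypothesis Tsystem : dynamical_system T.
Implicit Types (L W : seq (set X)) (U V : set (set X)) (S : {fset G}).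

Lemma refines_trans U V (W : set (set X)) :
  refines W V -> refines V U -> refines W U.
Proof.
move=> WV VU A /WV[B /VU[C UC BC] AB]; exists C => //; exact: subset_trans BC.
Qed.

(** In terms of orders, ord(W) is at most the sum of the ord(C i). *)
Lemma joins_open_seq (I : eqType) (r : seq I) (C : I -> seq (set X)) :
  (forall i, i \in r -> open_seq (C i) /\ covering (C i)) ->
  exists W, [/\ open_seq W, covering W,
    forall i, i \in r -> refines [set` W] [set` C i] &
    forall x, (mult W x + size r <= 1 + \sum_(i <- r) mult (C i) x)%N].
Proof.
elim: r => [_|i r ih rC].
  exists [:: setT]; split => //.
  - by move=> A; rewrite mem_seq1 => /eqP ->; exact: openT.
  - by move=> x; exists setT => //; rewrite mem_seq1.
  - by move=> x; rewrite big_nil /mult /= in_setT.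
have [|W [oW cW WC Wm]] := ih.
  by move=> j jr; apply: rC; rewrite in_cons jr orbT.
have [oCi cCi] := rC i (mem_head _ _).
have [W' [oW' cW' W'W W'C W'm]] := join_open_seq oW cW oCi cCi.
exists W'; split=> // [j|x].
  rewrite in_cons => /orP[/eqP-> //|jr].
  by apply: refines_trans W'W _; exact: WC.
rewrite big_cons /=; have := W'm x; have := Wm x.
set s := (\sum_(j <- r) _)%N.
move: s (mult W x) (mult W' x) (mult (C i) x) (size r) => s a a' c n; lia.
Qed.

Lemma refines_joinP V S U : refines V (join_cover T S U) <->
  forall g, g \in S -> refines V [set T g @` A | A in U].
Proof.
split=> [h g gS A /h[_ [u uU ->] Au]|h A VA].
  exists (T g @` u g); first by exists (u g) => //; exact: uU.
  by move=> x /Au; apply.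
have ex g : exists B, g \in S -> U B /\ A `<=` T g @` B.
  have [gS|gS] := boolP (g \in S); last by exists set0.
  by have [_ [B UB <-] AB] := h g gS A VA; exists B.
have /choice[u uP] := ex.
exists (\bigcap_(g in [set g | g \in S]) (T g @` u g)).
  by exists u => // g /uP[].
by move=> x Ax g /= /uP[_]; exact.
Qed.

Definition translate_seq g L := [seq T g @` A | A <- L].

Lemma open_image_act g (A : set X) : open A -> open (T g @` A).
Proof.
move=> oA; rewrite (image_act Tsystem); apply: open_comp => // x _.
exact: act_continuous.
Qed.

Lemma open_translate g L : open_seq L -> open_seq (translate_seq g L).
Proof. by move=> oL _ /mapP[A AL ->]; apply: open_image_act; exact: oL. Qed.

Lemma covering_translate g L : covering L -> covering (translate_seq g L).
Proof.
move=> cL x; have [A AL Ax] := cL (T g^-1%g x).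
by exists (T g @` A); [exact: map_f|rewrite (image_act Tsystem)].
Qed.

Lemma mult_translate g L x : mult (translate_seq g L) x = mult L (T g^-1%g x).
Proof.
rewrite mult_map; apply: eq_count => A; rewrite (image_act Tsystem).
by apply/idP/idP; rewrite !inE.
Qed.

Definition admissible U W :=
  [/\ open_seq W, covering W & refines [set` W] U].

(** The least order d is characterized by its attainment and by the existence,
for each cover refining U, of a point of order at least d; for nonempty X this
is minimality, in the form used to bound d from above. *)
Definition is_min_order U d :=
  (exists2 W, admissible U W & forall x, (mult W x <= d.+1)%N) /\
  (forall W, admissible U W -> exists x, (d < mult W x)%N).

Lemma min_order_le U d W e : is_min_order U d -> admissible U W ->
  (forall x, (mult W x <= e.+1)%N) -> (d <= e)%N.
Proof. by move=> [_ dU] /dU[x dx] /(_ x) /(leq_trans dx). Qed.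

Lemma is_min_order_exists U : [set: X] !=set0 ->
  (exists W, admissible U W) -> exists d, is_min_order U d.
Proof.
move=> [x0 _] [W0 aW0].
pose P d := `[< exists2 W, admissible U W & forall x, (mult W x <= d.+1)%N >].
have exP : exists d, P d.
  by exists (size W0); apply/asboolP; exists W0 => // x; apply: leqW; exact: count_size.
case: (ex_minnP exP) => d /asboolP dP dmin; exists d; split=> // W aW.
apply: contrapT => h.
have Wd x : (mult W x <= d)%N by rewrite leqNgt; apply/negP => dx; apply: h; exists x.
case: d => [|d] in dP dmin h Wd *.
  by have := Wd x0; rewrite leqNgt covering_mult_gt0 //; case: aW.
by have : (d.+1 <= d)%N; [apply: dmin; apply/asboolP; exists W|rewrite ltnn].
Qed.

Lemma min_ordE U d : [set: X] !=set0 -> is_min_order U d ->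
  min_ord U = (d%:R)%:E.
Proof.
move=> [x0 _] dU; apply/eqP; rewrite eq_le; apply/andP; split.
  have [[W [oW cW WU] Wd] _] := dU.
  apply: ge_ereal_inf.
  exists (ereal_sup [set (ord R [set` W] x)%:E | x in [set: X]]).
    by exists [set` W] => //; split=> //; exact: finite_open_cover_seq.
  apply: ge_ereal_sup => _ [x _ <-]; rewrite lee_fin.
  by apply: le_trans (ord_seq_le R W x) _; rewrite lerBlDr natr1 ler_nat.
apply: le_ereal_inf_tmp => _ [V [/finite_open_cover_enum[L [uL -> oL cL]] LU] <-].
have [x dx] := dU.2 L (And3 oL cL LU).
apply: le_trans (ereal_sup_ubound _); last by exists x.
by rewrite lee_fin ord_seq // lerBrDr natr1 ler_nat.
Qed.

Section JoinOrder.
Context (L : seq (set X)) (h : {fset G} -> nat).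
Hypothesis hP : forall S, is_min_order (join_cover T S [set` L]) (h S).

(** These properties of h are the hypotheses of [ornstein_weiss]. *)
Lemma join_order0 : h fset0 = 0%N.
Proof.
apply/eqP; rewrite -leqn0.
apply: (min_order_le (W := [:: setT]) (hP fset0)).
  split.
  - by move=> A; rewrite mem_seq1 => /eqP ->; exact: openT.
  - by move=> x; exists setT => //; rewrite mem_seq1.
  - by apply/refines_joinP => g; rewrite in_fset0.
by move=> x; rewrite /mult /= in_setT.
Qed.

Lemma join_orderU A B : (h (A `|` B)%fset <= h A + h B)%N.
Proof.
have [[V [oV cV VA] Vh] _] := hP A; have [[W [oW cW WB] Wh] _] := hP B.
have [Z [oZ cZ ZV ZW Zm]] := join_open_seq oV cV oW cW.
apply: (min_order_le (W := Z) (hP _)) => [|x].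
  split=> //; apply/refines_joinP => g; rewrite in_fsetU => /orP[gA|gB].
    by apply: refines_trans ZV _; move: VA => /refines_joinP; apply.
  by apply: refines_trans ZW _; move: WB => /refines_joinP; apply.
move: (Zm x) (Vh x) (Wh x).
by move: (mult V x) (mult W x) (mult Z x) (h A) (h B) => a b c p q; lia.
Qed.

Let join_order_ltrans_le c A : (h (ltrans c A) <= h A)%N.
Proof.
have [[V [oV cV VA] Vh] _] := hP A.
apply: (min_order_le (W := translate_seq c V) (hP _)) => [|x]; last first.
  by rewrite mult_translate.
split; [exact: open_translate|exact: covering_translate|].
apply/refines_joinP => g; rewrite in_ltrans => cgA _ /= /mapP[B BV ->].
move: VA => /refines_joinP/(_ _ cgA)/(_ B BV)[_ [D DL <-] BD].
exists (T g @` D); first by exists D.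
move=> _ [y By <-]; have [z Dz zy] := BD y By.
by exists z => //; rewrite -zy -(actM Tsystem) mulVKg.
Qed.

Lemma join_order_ltrans c A : h (ltrans c A) = h A.
Proof.
apply/eqP; rewrite eqn_leq join_order_ltrans_le /=.
rewrite {1}(_ : A = ltrans c^-1%g (ltrans c A)); first exact: join_order_ltrans_le.
by apply/fsetP => x; rewrite !in_ltrans invgK mulKg.
Qed.

End JoinOrder.

Lemma join_order_exists L : open_seq L -> covering L -> [set: X] !=set0 ->
  exists h : {fset G} -> nat, forall S, is_min_order (join_cover T S [set` L]) (h S).
Proof.
move=> oL cL X0.
suff /choice[h hP] : forall S, exists d,
  is_min_order (join_cover T S [set` L]) d by exists h.
move=> S; apply: is_min_order_exists => //.
have [g gS|W [oW cW WC _]] := @joins_open_seq G (S : seq G) (translate_seq^~ L).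
  by split; [exact: open_translate|exact: covering_translate].
exists W; split=> //; apply/refines_joinP => g /WC WCg; apply: refines_trans WCg _.
by move=> _ /= /mapP[A AL ->]; exists (T g @` A) => //; exists A.
Qed.

End Orders.

(** * Orders of joins are bounded by integrals of orders *)

Lemma sub_in_count (I : eqType) (a1 a2 : pred I) (r : seq I) :
  (forall i, i \in r -> a1 i -> a2 i) -> (count a1 r <= count a2 r)%N.
Proof.
elim: r => //= i r ih h; apply: leq_add.
  by move: (h i (mem_head _ _)); case: (a1 i) => // ->.
by apply: ih => j jr; apply: h; rewrite in_cons jr orbT.
Qed.

Section Comparison.
Context (R : realType) (G : groupType) (X : metricType R) (T : G -> X -> X).
Context (F : nat -> {fset G}).
Hypothesis Xcompact : compact [set: X].
Hypothesis Tsystem : dynamical_system T.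
Hypothesis Ffolner : folner R F.

Let F_gt0 n : 0 < #|` F n|%:R :> R.
Proof. by rewrite ltr0n lt0n cardfs_eq0; case: Ffolner. Qed.

(** Uniformity over x is what a weak limit of empirical measures provides for upper
semicontinuous functions; here the function is the multiplicity of closed
sets. *)
Lemma orbit_averages_eventually_lt (Ks : seq (set X)) (c : R) :
  (forall K, K \in Ks -> closed K) ->
  (forall mu : invariant_probability T, \sum_(K <- Ks) prob mu K < c) ->
  \forall n \near \oo, forall x,
    (\sum_(g <- F n) mult Ks (T g^-1%g x))%:R < c * #|` F n|%:R.
Proof.
move=> Kc Kmu; apply: contrapT => not_ev.
have [N|mu] := empirical_limit (c := c) Xcompact Tsystem Ffolner Kc.
  apply: contrapT => h; apply: not_ev; exists N => // n /= Nn x.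
  by rewrite ltNge; apply/negP => cx; apply: h; exists n => //; exists x.
rewrite big_seq; under eq_bigr => K KK.
  rewrite -probE; last by apply: closed_borel_measurable; exact: Kc.
  over.
by rewrite -big_seq sumEFin lee_fin leNgt Kmu.
Qed.

(** Joining the translates of a shrinking of V over F n bounds h (F n) by sums of
ord(V) along orbits, which are under control by the previous lemma. *)
Lemma order_eventually_le (L : seq (set X)) (h : {fset G} -> nat)
    (V : set (set X)) (c : R) :
  (forall S, is_min_order (join_cover T S [set` L]) (h S)) ->
  finite_open_cover V -> refines V [set` L] ->
  (sup_integral_ord T V < c%:E)%E ->
  \forall n \near \oo, (h (F n))%:R <= c * #|` F n|%:R.
Proof.
move=> hP /finite_open_cover_enum[M [uM -> oM cM]] ML Mc.
have [Os [Ks [oO cO OM Kc OK]]] := shrink_open_seq oM cM.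
have Ks_lt (mu : invariant_probability T) : \sum_(K <- Ks) prob mu K < c + 1.
  have : (\int[law mu]_x (ord R [set` M] x)%:E < c%:E)%E.
    by apply: le_lt_trans Mc; apply: ereal_sup_ubound; exists mu.
  rewrite integral_ord // lte_fin ltrBlDr; apply: le_lt_trans.
  rewrite -[leRHS]mul1r; apply: sum_prob_le => //.
  - by move=> K KK; apply: closed_borel_measurable; exact: Kc.
  - exact: borel_seq_open.
  - by move=> x; rewrite mul1r ler_nat; case/andP: (OK x).
apply: filterS (orbit_averages_eventually_lt Kc Ks_lt) => n hn.
have [g gF|W [oW cW WO Wm]] :=
    @joins_open_seq R X G (F n : seq G) (translate_seq T ^~ Os).
  by split; [exact: open_translate|exact: covering_translate].
have [|x hx] := (hP (F n)).2 W.
  split=> //; apply/refines_joinP => g /WO WOg; apply: refines_trans WOg _.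
  move=> _ /= /mapP[A /OM[B /= /ML[D DL BD] AB] ->].
  exists (T g @` D); first by exists D.
  by apply: image_subset; exact: subset_trans BD.
have : (h (F n) + #|` F n| <= \sum_(g <- F n) mult Ks (T g^-1%g x))%N.
  have le1 : (\sum_(g <- F n) mult (translate_seq T g Os) x <=
      \sum_(g <- F n) mult Ks (T g^-1%g x))%N.
    by apply: leq_sum => g _; rewrite mult_translate //; case/andP: (OK (T g^-1%g x)).
  move: (Wm x) le1; set a := (\sum_(g <- F n) _)%N; set b := (\sum_(g <- F n) _)%N.
  rewrite -[size _]/(#|` F n|); move: hx.
  move: a b (mult W x) (h (F n)) #|` F n| => a b w k m; lia.
by rewrite -(ler_nat R) natrD; have := hn x; lra.
Qed.

(** By the bound on orbit averages, for some n every orbit piece over F n spends a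
proportion less than e of its time in Y. This is a condition on finitely many
points of the orbit, so by compactness it persists for a neighbourhood N of Y;
integrating the number of visits to N bounds its measure. *)
Lemma uniformly_small_neighborhood (Y : set X) (e : R) : closed Y -> 0 < e ->
  (forall mu : invariant_probability T, prob mu Y < e) ->
  exists N, [/\ open N, Y `<=` N & forall mu : invariant_probability T, prob mu N <= e].
Proof.
move=> cY e0 Ye.
have ev : \forall n \near \oo, forall x, (visits T (F n) x Y)%:R < e * #|` F n|%:R.
  have := @orbit_averages_eventually_lt [:: Y] e; case => [K|mu|n _ hn].
  - by rewrite mem_seq1 => /eqP ->.
  - by rewrite big_seq1.
  - by exists n => // m /hn + x => /(_ x); rewrite sum_mult_visits big_seq1.
have [n _ /(_ n (leqnn n)) hn] := ev.
pose f := depth (~` Y).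
have oYc : open (~` Y) by exact: closed_openC.
pose N (eta : R) := [set x | f x < eta].
pose good (eta : R) x := (visits T (F n) x (N eta))%:R < e * #|` F n|%:R.
have near_good : \forall eta \near 0^'+, [set: X] `<=` good eta.
  apply: (iffLR (compact_near_coveringP _) Xcompact _ _ good) => x _.
  pose FF : set_system (X * R) := filter_prod (nbhs x) 0^'+.
  have FF_filter : Filter FF by exact: filter_prod_filter.
  suff : FF [set p | good p.2 p.1] by [].
  have : FF [set p | forall g, g \in (F n : seq G) ->
      N p.2 (T g^-1%g p.1) -> Y (T g^-1%g x)].
    elim: (F n : seq G) => [|g r ih]; first by apply: (@filterE _ FF) => p g.
    have near_g : FF [set p | N p.2 (T g^-1%g p.1) -> Y (T g^-1%g x)].
      have [Yx|nYx] := pselect (Y (T g^-1%g x)); first by apply: (@filterE _ FF) => p _.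
      have fx : 0 < f (T g^-1%g x) by apply/depth_gt0P.
      exists ([set y | f (T g^-1%g x) / 2 < f (T g^-1%g y)],
              [set eta | eta < f (T g^-1%g x) / 2]).
        split; last by apply: nbhs_right_lt; rewrite divr_gt0.
        have cfT : {for x, continuous (f \o T g^-1%g)}.
          apply: continuous_comp; first exact: act_continuous.
          exact: depth_continuous.
        by move: cfT => /cvgr_gt; apply; rewrite /= gtr_pMr //; lra.
      move=> [y eta] /= [hy heta]; rewrite /N /= => hN.
      by have := lt_trans hy (lt_trans hN heta); rewrite ltxx.
    move: near_g ih; apply: (@filterS2 _ FF) => p pg ih k.
    by rewrite in_cons => /orP[/eqP-> //|]; exact: ih.
  apply: (@filterS _ FF) => -[y eta] hg; rewrite /good /=; apply: le_lt_trans (hn x).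
  rewrite ler_nat; apply: sub_in_count => g gF /=; rewrite !inE.
  exact: hg.
have [eta [eta0 hN]] : exists eta, 0 < eta /\ forall x, good eta x.
  have : \forall eta \near 0^'+, 0 < eta /\ [set: X] `<=` good eta.
    apply: filterS2 near_good; last exact: nbhs_right_gt.
    by move=> r r0 hr; split; [exact: r0|].
  by move=> /filter_ex[eta [eta0 hN]]; exists eta; split=> // x; exact: hN.
exists (N eta); split.
- apply: open_lt_continuous; first exact: depth_continuous.
  by move=> x; exact: cvg_cst.
- move=> y Yy; rewrite /N /=; apply: le_lt_trans eta0; rewrite leNgt.
  by apply/negP => /(depth_gt0P _ oYc).
- move=> mu; have oN : open (N eta).
    apply: open_lt_continuous; first exact: depth_continuous.
    by move=> x; exact: cvg_cst.
  rewrite -(ler_pM2r (F_gt0 n)).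
  have -> : prob mu (N eta) * #|` F n|%:R =
      \sum_(A <- [seq T g @` N eta | g <- F n]) prob mu A.
    rewrite big_map; under eq_bigr do rewrite prob_act //.
    by rewrite big_const_seq count_predT iter_addr_0 mulr_natr.
  apply: sum_prob_le_cst.
  + apply: borel_seq_open => _ /mapP[g _ ->]; exact: open_image_act.
  + by rewrite mulr_ge0 // ltW.
  + move=> x; apply: le_trans (ltW (hN x)); rewrite ler_nat mult_map eq_leq //.
    by apply: eq_count => g; rewrite (image_act Tsystem); apply/idP/idP; rewrite !inE.
Qed.

End Comparison.

(** * Integrals of orders are bounded by orders of joins *)

Section Inverses.
Context (R : realType) (G : groupType).
Implicit Types (S K : {fset G}).

Definition fset_inv S : {fset G} := [fset s^-1%g | s in S]%fset.

Lemma in_fset_inv S x : (x \in fset_inv S) = (x^-1%g \in S).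
Proof.
apply/imfsetP/idP => [[y /= yS ->]|xS]; first by rewrite invgK.
by exists x^-1%g; rewrite ?invgK.
Qed.

Lemma card_fset_inv S : #|` fset_inv S| = #|` S|.
Proof. by rewrite card_imfset //; exact: (can_inj (@invgK _)). Qed.

Lemma right_invariant_fset_inv K (e : R) S :
  invariant_fset (fset_inv K) e S -> right_invariant K e (fset_inv S).
Proof.
move=> [S0 bS]; split; first by rewrite -cardfs_eq0 card_fset_inv cardfs_eq0.
move=> k kK; have := bS k^-1%g; rewrite in_fset_inv invgK card_fset_inv => /(_ kK).
rewrite -[X in X%:R < _]card_fset_inv; congr (_%:R < _); congr #|` _|.
apply/fsetP => x; rewrite in_fset_inv /fsymdiff !(in_fsetU, in_fsetD).
by rewrite in_rtrans !in_fset_inv !(in_ltrans k^-1%g S) invgM !invgK.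
Qed.

End Inverses.

Lemma mult_allpairs (X I : Type) (r : seq I) (D : I -> seq (set X))
    (f : I -> set X -> set X) x :
  mult [seq f p A | p <- r, A <- D p] x = (\sum_(p <- r) mult [seq f p A | A <- D p] x)%N.
Proof.
elim: r => [|p r ih]; first by rewrite big_nil.
by rewrite big_cons -ih /mult /= count_cat.
Qed.

Lemma mult_setI (X : Type) (V : set X) (L : seq (set X)) x :
  mult [seq V `&` A | A <- L] x = ((x \in V) * mult L x)%N.
Proof.
rewrite /mult count_map; case: (boolP (x \in V)) => xV; rewrite ?mul1n ?mul0n.
  by apply: eq_count => A /=; rewrite in_setI xV.
by rewrite -(count_pred0 L); apply: eq_count => A /=; rewrite in_setI (negbTE xV).
Qed.

Lemma sum_index (I : eqType) (x0 : I) (r : seq I) (f : nat -> nat) : uniq r ->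
  (\sum_(i <- r) f (index i r) = \sum_(j <- iota 0 (size r)) f j)%N.
Proof.
move=> ur; rewrite (big_nth x0) /index_iota subn0 big_seq [RHS]big_seq.
by apply: eq_bigr => j; rewrite mem_iota => /= jr; rewrite index_uniq.
Qed.

Section Towers.
Context (R : realType) (G : groupType) (X : metricType R) (T : G -> X -> X).
Context (F : nat -> {fset G}).
Hypothesis Xcompact : compact [set: X].
Hypothesis Tsystem : dynamical_system T.
Hypothesis Ffolner : folner R F.

Lemma disjoint_tower_measure (I : eqType) (tw : seq (I * G)) (V : I -> set X)
    (mu : invariant_probability T) : uniq tw -> (forall i, open (V i)) ->
  trivIset [set` tw] (fun p => T p.2 @` V p.1) ->
  \sum_(p <- tw) prob mu (V p.1) <= 1.
Proof.
move=> utw oV triv.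
have -> : \sum_(p <- tw) prob mu (V p.1) =
    \sum_(A <- [seq T p.2 @` V p.1 | p <- tw]) prob mu A.
  by rewrite big_map; apply: eq_bigr => p _; rewrite prob_act.
apply: sum_prob_le_cst => // [|x].
  by apply: borel_seq_open => _ /mapP[p _ ->]; exact: open_image_act.
rewrite mult_map lern1 leqNgt -size_filter; apply/negP.
set r := [seq p <- tw | _]; case rE: r => [|p [|q r']] // _.
have ur : uniq r by rewrite filter_uniq.
have inr p' : p' \in r -> p' \in tw /\ (T p'.2 @` V p'.1) x.
  by rewrite mem_filter => /andP[/set_mem].
have [ptw px] := inr p ltac:(by rewrite rE mem_head).
have [qtw qx] := inr q ltac:(by rewrite rE !inE eqxx orbT).
have pq : p = q by apply: (triv p q) => //; exists x.
by move: ur; rewrite rE pq /= mem_head.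
Qed.

(** The levels of a tower with base V i receive the members of the covers D i s
obtained by splitting, which refine U once moved to the level s. By invariance
the levels of the tower contribute the sum over s of the measures of the
members of D i s inside V i, at most |S i| + h(S i^-1) times the measure of
V i; the total mass 1 + b + e drops to b + e when passing from multiplicities
to orders. *)
Lemma tower_cover (L : seq (set X)) (h : {fset G} -> nat) (b e : R) :
  open_seq L -> covering L ->
  (forall S, is_min_order (join_cover T S [set` L]) (h S)) ->
  0 <= b -> 0 < e -> density_bound h (b + e) -> uniform_rokhlin T ->
  exists V, [/\ finite_open_cover V, refines V [set` L] &
    (sup_integral_ord T V <= (b + 2 * e)%:E)%E].
Proof.
move=> oL cL hP b0 e0 [K [d d0 hK]] URP.
pose e' := Num.min d (e / (size L).+1%:R).
have e'0 : 0 < e' by rewrite lt_min d0 divr_gt0 // ltr0n.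
have [r [V [S [oV IS triv supY]]]] := URP (fset_inv K) e' e'0.
have hS i : (h (fset_inv (S i)))%:R <= (b + e) * #|` S i|%:R.
  rewrite -card_fset_inv; apply: hK; apply: right_invariant_fset_inv.
  have [S0 bS] := IS i; split=> // k /bS /lt_le_trans; apply.
  by rewrite ler_wpM2r // ge_min lexx.
pose tw := [seq (i, s) | i <- enum 'I_r, s <- (S i : seq G)].
have in_tw p : (p \in tw) = (p.2 \in S p.1).
  apply/allpairsPdep/idP => [[i [s [_ sS ->]]] //|pS].
  by exists p.1, p.2; rewrite mem_enum; split=> //; case: p pS.
have utw : uniq tw.
  rewrite allpairs_uniq_dep ?enum_uniq // => [i _|[i s] [j t] _ _ /= [-> ->] //].
  exact: fset_uniq.
set Y := (~` _) in supY.
have cY : closed Y.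
  apply: open_closedC; apply: bigcup_open => i _; apply: bigcup_open => g _.
  exact: open_image_act.
have muY (mu : invariant_probability T) : prob mu Y < e'.
  rewrite -lte_fin probE; last exact: closed_borel_measurable.
  by apply: le_lt_trans supY; apply: ereal_sup_ubound; exists mu.
have [N [oN YN muN]] :=
  uniformly_small_neighborhood Xcompact Tsystem Ffolner cY e'0 muY.
have /choice[C CP] : forall i, exists C : nat -> seq (set X),
    (forall j, (j < #|` S i|)%N -> [/\ open_seq (C j), covering (C j) &
       refines [set` C j] (join_cover T (fset_inv (S i)) [set` L])]) /\
    (forall x, (\sum_(j <- iota 0 #|` S i|) mult (C j) x <=
       #|` S i| + h (fset_inv (S i)))%N).
  move=> i; have [[W [oW cW WL] Wh] _] := hP (fset_inv (S i)).
  have Si0 : (0 < #|` S i|)%N by rewrite lt0n cardfs_eq0; case: (IS i).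
  have [C [CP Csum]] := split_open_seq Si0 oW cW.
  exists C; split=> [j /CP[oC cC CW]|x]; first by split=> //; exact: refines_trans WL.
  move: (Csum x) (Wh x); set a := (\sum_(j <- _) _)%N.
  by move: a (mult W x) => a w; lia.
pose D i s := C i (index s (S i : seq G)).
have DP p : p \in tw -> [/\ open_seq (D p.1 p.2), covering (D p.1 p.2) &
    refines [set` D p.1 p.2] (join_cover T (fset_inv (S p.1)) [set` L])].
  by rewrite in_tw => pS; apply: (CP p.1).1; rewrite index_mem.
pose towers := [seq T p.2 @` (V p.1 `&` A) | p <- tw, A <- D p.1 p.2].
pose rest := [seq N `&` A | A <- L].
pose Cov := towers ++ rest.
have oCov : open_seq Cov.
  move=> A; rewrite mem_cat => /orP[/allpairsPdep[p [B [ptw BD ->]]]|/mapP[B BL ->]].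
    apply: open_image_act => //; apply: openI => //.
    by have [oD _ _] := DP p ptw; exact: oD.
  by apply: openI => //; exact: oL.
have cCov : covering Cov.
  move=> x; have [Yx|/contrapT[i _ [s /= sS [y Vy yx]]]] := pselect (Y x).
    have [A AL Ax] := cL x; exists (N `&` A); last by split=> //; exact: YN.
    by rewrite mem_cat map_f ?orbT.
  have ptw : (i, s) \in tw by rewrite in_tw.
  have [_ cD _] := DP _ ptw; have [A AD Ay] := cD y.
  exists (T s @` (V i `&` A)); last by exists y.
  by rewrite mem_cat; apply/orP; left; apply/allpairsPdep; exists (i, s), A.
have CovL : refines [set` Cov] [set` L].
  move=> A /=; rewrite mem_cat => /orP[/allpairsPdep[p [B [ptw BD ->]]]|/mapP[B BL ->]].
    have [_ _ /(_ B BD)[_ [u uL ->] Bu]] := DP p ptw.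
    have p2S : p.2^-1%g \in fset_inv (S p.1) by rewrite in_fset_inv invgK -in_tw.
    exists (u p.2^-1%g); first exact: uL.
    move=> _ [y [_ /Bu/(_ _ p2S)] + <-].
    by rewrite (image_act Tsystem) /= invgK.
  by exists B => // x [].
exists [set` Cov]; split=> //; first exact: finite_open_cover_seq.
apply: ge_ereal_sup => _ [mu _ <-].
apply: le_trans (integral_ord_le mu oCov cCov) _.
rewrite lee_fin lerBlDr big_cat /=.
have rest_le : \sum_(A <- rest) prob mu A <= e.
  apply: (@le_trans _ _ ((size L)%:R * \sum_(A <- [:: N]) prob mu A)).
    apply: sum_prob_le => //.
    - by apply: borel_seq_open => _ /mapP[A AL ->]; apply: openI => //; exact: oL.
    - by apply: borel_seq_open => A; rewrite mem_seq1 => /eqP ->.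
    - move=> x; rewrite mult_setI -natrM ler_nat /mult /= addn0 mulnC.
      by rewrite leq_mul2r count_size orbT.
  rewrite big_seq1; apply: le_trans (_ : (size L).+1%:R * e' <= _); last first.
    by rewrite mulrC -ler_pdivlMr ?ltr0n // ge_min lexx orbT.
  by apply: ler_pM => //; rewrite ?prob_ge0 ?ler_nat.
have towers_le : \sum_(A <- towers) prob mu A <= 1 + b + e.
  have -> : \sum_(A <- towers) prob mu A =
      \sum_(p <- tw) \sum_(A <- D p.1 p.2) prob mu (V p.1 `&` A).
    rewrite big_allpairs_dep /=; apply: eq_big_seq => p ptw; apply: eq_big_seq => A AD.
    rewrite prob_act //; apply: openI => //.
    by have [oD _ _] := DP p ptw; exact: oD.
  have base_le i : \sum_(s <- S i) \sum_(A <- D i s) prob mu (V i `&` A) <=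
      (1 + b + e) * (#|` S i|%:R * prob mu (V i)).
    have -> : \sum_(s <- S i) \sum_(A <- D i s) prob mu (V i `&` A) =
        \sum_(B <- [seq V i `&` A | s <- (S i : seq G), A <- D i s]) prob mu B.
      by rewrite big_allpairs_dep.
    apply: (@le_trans _ _ ((#|` S i| + h (fset_inv (S i)))%:R *
        \sum_(A <- [:: V i]) prob mu A)).
      apply: sum_prob_le => //.
      - apply: borel_seq_open => _ /allpairsPdep[s [A [sS AD ->]]]; apply: openI => //.
        by have [|oD _ _] := DP (i, s); [rewrite in_tw|exact: oD].
      - by apply: borel_seq_open => A; rewrite mem_seq1 => /eqP ->.
      - move=> x; rewrite mult_allpairs -natrM ler_nat /mult /= addn0.
        under eq_bigr do rewrite -/(mult _ _) mult_setI.
        rewrite -big_distrr /= mulnC leq_mul2r; apply/orP; right.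
        rewrite (sum_index 1%g (fun j => mult (C i j) x)) ?fset_uniq //.
        exact: (CP i).2.
    rewrite big_seq1 mulrA ler_wpM2r ?prob_ge0 // natrD.
    by have := hS i; lra.
  rewrite [X in X <= _]big_allpairs_dep /=.
  apply: le_trans (ler_sum _ (fun i _ => base_le i)) _.
  rewrite -big_distrr /= -[leRHS]mulr1 ler_wpM2l //; first by lra.
  apply: le_trans (disjoint_tower_measure mu utw oV _); last first.
    by move=> p q /=; rewrite !in_tw; exact: triv.
  rewrite big_allpairs_dep /=; apply: ler_sum => i _.
  by rewrite big_const_seq count_predT iter_addr_0 mulr_natl.
by move: rest_le towers_le; lra.
Qed.

End Towers.

(** * The two dimensions *)

(** The limit given by [ornstein_weiss] is at most the right-hand side by
[order_eventually_le], and at least by [tower_cover]. *)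
Lemma limn_min_ord (R : realType) (G : groupType) (X : metricType R)
    (T : G -> X -> X) (F : nat -> {fset G}) (U : set (set X)) :
  [set: X] !=set0 -> compact [set: X] -> dynamical_system T ->
  uniform_rokhlin T -> folner R F -> finite_open_cover U ->
  limn (fun n => (#|` F n|%:R^-1)%:E * min_ord (join_cover T (F n) U))%E =
  ereal_inf [set sup_integral_ord T V
            | V in [set V | finite_open_cover V /\ refines V U]].
Proof.
move=> X0 Xc Ts URP FF /finite_open_cover_enum[L [uL -> oL cL]].
have [h hP] := join_order_exists Ts oL cL X0.
have [b [b0 hb bP]] := ornstein_weiss (join_order0 hP) (join_orderU hP)
  (join_order_ltrans Ts hP) FF.
have F_gt0 n : 0 < #|` F n|%:R :> R by rewrite ltr0n lt0n cardfs_eq0; case: FF.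
transitivity (b%:E).
  apply/cvg_lim => //.
  rewrite [X in X @ _ --> _](_ : _ = EFin \o (fun n => (h (F n))%:R / #|` F n|%:R)).
    by apply/fine_cvgP; split; [exact: nearW|exact: hb].
  by apply/funext => n /=; rewrite (min_ordE X0 (hP (F n))) -EFinM mulrC.
apply/eqP; rewrite eq_le; apply/andP; split.
  apply: le_ereal_inf_tmp => _ [V [fV VL] <-].
  have below (c : R) : (sup_integral_ord T V < c%:E)%E -> b <= c.
    move=> Vc; have ev := order_eventually_le Xc Ts FF hP fV VL Vc.
    by apply: (cvgr_to_le hb); apply: filterS ev => n; rewrite ler_pdivrMr.
  case: (sup_integral_ord T V) below => [a| |] below.
  - rewrite lee_fin; apply/ler_addgt0Pr => e e0; apply: below.
    by rewrite lte_fin ltrDl.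
  - by rewrite leey.
  - by have := below (b - 1) (ltNyr _); rewrite lerBrDr gerDl ler10.
apply/lee_addgt0Pr => e e0; have e2 : 0 < e / 2 by rewrite divr_gt0.
have [V [fV VL Vb]] := tower_cover Xc Ts FF oL cL hP b0 e2 (bP _ e2) URP.
apply: ge_ereal_inf; exists (sup_integral_ord T V); first by exists V.
by apply: le_trans Vb _; rewrite -EFinD lee_fin; lra.
Qed.

(** Without points there are neither invariant measures nor values of the order:
the suprema over them are -oo, hence so are both sides. *)
Lemma mdim_empty (R : realType) (G : groupType) (X : metricType R)
    (T : G -> X -> X) (F : nat -> {fset G}) :
  folner R F -> ~ ([set: X] !=set0) -> mdim F T = measure_dim T.
Proof.
move=> [F0 _] Xe; have noX (x : X) : False by apply: Xe; exists x.
have refl U : refines U (U : set (set X)) by move=> A UA; exists A.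
rewrite /mdim /measure_dim; congr ereal_sup; apply/eq_imagel => U fU.
transitivity (-oo%E : \bar R); last first.
  apply/esym/eqP; rewrite -leeNy_eq; apply: ge_ereal_inf.
  exists (sup_integral_ord T U); first by exists U.
  by apply: ge_ereal_sup => _ [mu _ <-]; case: (noX (base_point mu)).
apply/cvg_lim => //.
rewrite [X in X @ _ --> _](_ : _ = cst -oo%E); first exact: cvg_cst.
apply/funext => n /=.
have -> : min_ord (join_cover T (F n) U) = -oo%E.
  apply/eqP; rewrite -leeNy_eq; apply: ge_ereal_inf.
  exists (ereal_sup [set (ord R (set0 : set (set X)) x)%:E | x in [set: X]]).
    exists set0 => //; split=> [|A //]; split=> //.
    by apply/seteqP; split=> x; case: (noX x).
  by apply: ge_ereal_sup => _ [x _ <-]; case: (noX x).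
by rewrite gt0_muleNy // lte_fin invr_gt0 ltr0n lt0n cardfs_eq0.
Qed.

Theorem theorem9p2 (R : realType) (G : groupType) (X : metricType R)
    (T : G -> X -> X) (F : nat -> {fset G})
    (Gcountable : countable [set: G]) (Gamenable : amenable R G)
    (Xcompact : compact [set: X]) (Tsystem : dynamical_system T)
    (TURP : uniform_rokhlin T) (Ffolner : folner R F) :
  mdim F T = measure_dim T.
Proof.
have [X0|Xe] := pselect ([set: X] !=set0); last exact: mdim_empty.
rewrite /mdim /measure_dim; congr ereal_sup; apply/eq_imagel => U fU.
exact: limn_min_ord.
Qed.
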